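(* Let $(N^{2n+1},\varphi,\xi,\eta,g)$ be a Sasakian space form with constant $\varphi$-sectional curvature $c\neq1$ and $n\ge2$, and let $\gamma:I\to N$ be a non-Legendre Frenet curve of osculating order $r$ (with $\eta(T)$ not assumed constant) such that $\nabla_TT\perp\varphi T$. Then $\gamma$ is proper-biharmonic if and only if either a) $\gamma$ is a circle with $\eta(T)=\cos\beta_0$ and $\kappa_1^2=\frac{c+3}{4}-\frac{c-1}{4}\cos^2\beta_0$, or b) $\gamma$ is a helix with $\eta(T)=\cos\beta_0$ and $\kappa_1^2+\kappa_2^2=\frac{c+3}{4}-\frac{c-1}{4}\cos^2\beta_0$, where $\beta_0\in(0,2\pi)\setminus\{\frac{\pi}{2},\pi,\frac{3\pi}{2}\}$ is a constant such that $\frac{c+3}{4}-\frac{c-1}{4}\cos^2\beta_0>0$.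
   Context: All manifolds, metrics, connections and maps are smooth. A contact metric manifold $(N^{2n+1},\varphi,\xi,\eta,g)$ consists of a $(1,1)$-tensor field $\varphi$, a vector field $\xi$ (the characteristic vector field), a 1-form $\eta$ and a Riemannian metric $g$ with $\varphi^2=-I+\eta\otimes\xi$, $\eta(\xi)=1$, $g(\varphi X,\varphi Y)=g(X,Y)-\eta(X)\eta(Y)$, $g(X,\varphi Y)=d\eta(X,Y)$, where $d\eta(X,Y)=\frac12(X\eta(Y)-Y\eta(X)-\eta([X,Y]))$. It is Sasakian if $(\nabla_X\varphi)(Y)=g(X,Y)\xi-\eta(Y)X$ for all vector fields $X,Y$, with $\nabla$ the Levi-Civita connection. A Sasakian space form is a Sasakian manifold whose $\varphi$-sectional curvature (the sectional curvature of the planes spanned by $X,\varphi X$, with $X$ a unit vector orthogonal to $\xi$) is a constant $c$. A curve $\gamma:I\to N$ parametrized by arc length is a Frenet curve of osculating order $r$ ($1\le r\le \dim N$) if there are orthonormal vector fields $E_1=\gamma'=T,E_2,\dots,E_r$ along $\gamma$ with $\nabla_TE_1=\kappa_1E_2$, $\nabla_TE_2=-\kappa_1E_1+\kappa_2E_3$, ..., $\nabla_TE_r=-\kappa_{r-1}E_{r-1}$, where $\kappa_1,\dots,\kappa_{r-1}$ are positive functions on $I$. A Frenet curve of osculating order 1 is a geodesic; a circle is a Frenet curve of osculating order 2 with $\kappa_1$ constant; a helix is a Frenet curve of osculating order 3 with $\kappa_1,\kappa_2$ constant. The curve $\gamma$ is non-Legendre: $\eta(T)=f$ with $f$ a function along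 $\gamma$, $f\neq0$. A curve $\gamma$ parametrized by arc length is biharmonic if $\tau_2(\gamma)=\nabla_T^3T-R(T,\nabla_TT)T=0$, where $R(X,Y)=[\nabla_X,\nabla_Y]-\nabla_{[X,Y]}$; it is proper-biharmonic if it is biharmonic and not harmonic (i.e. not a geodesic). *)

(* Defs.v *)
From mathcomp Require Import all_boot all_order all_algebra.
From mathcomp Require Import all_classical all_reals all_analysis.
From mathcomp Require Import ring.

Set Implicit Arguments.
Unset Strict Implicit.
Unset Printing Implicit Defensive.

Import Order.TTheory GRing.Theory Num.Theory.
Import numFieldNormedType.Exports.

Local Open Scope classical_set_scope.
Local Open Scope ring_scope.

(** Differential geometry in local coordinates.  Tangent vectors at a point of
    an [m]-dimensional manifold are represented, in each chart, by their row of
    components ['rV_m]; linear maps act on the right, so that a vector with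
    components [u] in one chart has components [u *m 'J f x] in another one,
    [f] being the change of coordinates. *)

Section Smoothness.
Variables (R : realType) (V W : normedModType R).

(* C^infinity on the open set [U], for V finite-dimensional: all the iterated
   derivatives in constant directions are (Frechet) differentiable on [U]. *)
Definition smooth_on (U : set V) (f : V -> W) :=
  forall (s : seq V) (x : V), U x -> differentiable (foldr (fun v h => 'D_v h) f s) x.

End Smoothness.

Section LocalGeometry.
Variables (R : realType) (m : nat).
Notation vec := 'rV[R]_m.

Definition inner (A : 'M[R]_m) (u v : vec) : R := (u *m A *m v^T) 0 0.

Definition bracket (X Y : vec -> vec) : vec -> vec :=
  fun x => 'D_(X x) Y x - 'D_(Y x) X x.

(* [G x] is the Gram matrix of the metric at the point with coordinates [x]. *)
Variable G : vec -> 'M[R]_m.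

Definition christoffel (x : vec) (k i j : 'I_m) : R :=
  let d (l : 'I_m) := 'D_(delta_mx 0 l) G x in
  2^-1 * \sum_l invmx (G x) k l * (d i j l + d j i l - d l i j).

Definition christoffel_form (x u v : vec) : vec :=
  \row_k \sum_i \sum_j christoffel x k i j * u 0 i * v 0 j.

(* The Levi-Civita connection; see [nabla_torsion_free] and [nabla_metric]. *)
Definition nabla (X Y : vec -> vec) : vec -> vec :=
  fun x => 'D_(X x) Y x + christoffel_form x (X x) (Y x).

Definition curvature (X Y Z : vec -> vec) : vec -> vec :=
  fun x => nabla X (nabla Y Z) x - nabla Y (nabla X Z) x - nabla (bracket X Y) Z x.

(* The value of the curvature tensor on three tangent vectors at [x]: since the
   curvature is tensorial, any extension to vector fields can be used. *)
Definition curvature_at (x u v w : vec) : vec :=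
  curvature (cst u) (cst v) (cst w) x.

Definition sectional_curvature (x u v : vec) : R :=
  inner (G x) (curvature_at x u v v) u /
  (inner (G x) u u * inner (G x) v v - inner (G x) u v ^+ 2).

End LocalGeometry.

(* The connection of the Christoffel symbols is the torsion-free metric one. *)
Section LeviCivita.
Variables (R : realType) (m : nat).
Notation vec := 'rV[R]_m.

Lemma innerE (A : 'M[R]_m) (u v : vec) :
  inner A u v = \sum_i \sum_j A i j * u 0 i * v 0 j.
Proof.
rewrite /inner mxE exchange_big; apply: eq_bigr => j _.
by rewrite mxE mulr_suml mxE; apply: eq_bigr => i _; rewrite (mulrC (u 0 i)).
Qed.

Lemma derive_inner (A : vec -> 'M[R]_m) (Y Z : vec -> vec) (x v : vec) :
  derivable A x v -> derivable Y x v -> derivable Z x v ->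
  'D_v (fun y => inner (A y) (Y y) (Z y)) x
  = inner ('D_v A x) (Y x) (Z x) + inner (A x) ('D_v Y x) (Z x)
    + inner (A x) (Y x) ('D_v Z x).
Proof.
move=> dA dY dZ.
have eA i j : is_derive x v (fun y => A y i j) ('D_v A x i j).
  by rewrite derive_mx// mxE; apply: derivableP; exact: ((derivable_mxP _ _ _).1 dA).
have eY j : is_derive x v (fun y => Y y 0 j) ('D_v Y x 0 j).
  by rewrite derive_mx// mxE; apply: derivableP; exact: ((derivable_mxP _ _ _).1 dY).
have eZ j : is_derive x v (fun y => Z y 0 j) ('D_v Z x 0 j).
  by rewrite derive_mx// mxE; apply: derivableP; exact: ((derivable_mxP _ _ _).1 dZ).
have -> : (fun y => inner (A y) (Y y) (Z y)) =
   \sum_i \sum_j ((fun y => A y i j) * (fun y => Y y 0 i) * (fun y => Z y 0 j)).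
  apply/funext => y; rewrite innerE fct_sumE; apply: eq_bigr => i _.
  by rewrite fct_sumE.
rewrite derive_val !innerE -!big_split /=; apply: eq_bigr => i _.
rewrite -!big_split /=; apply: eq_bigr => j _.
have key (a b c a' b' c' : R) :
    (a * b) * c' + c * (a * b' + b * a') = a' * b * c + a * b' * c + a * b * c'.
  by ring.
exact: key.
Qed.

Variable G : vec -> 'M[R]_m.

Lemma inner_christoffel (x u v w : vec) :
  G x \in unitmx -> (G x)^T = G x ->
  inner (G x) (christoffel_form G x u v) w
  = 2^-1 * \sum_i \sum_j \sum_l ('D_(delta_mx 0 i) G x j l
       + 'D_(delta_mx 0 j) G x i l - 'D_(delta_mx 0 l) G x i j)
       * u 0 i * v 0 j * w 0 l.
Proof.
move=> Gu Gs; pose t l i j := 'D_(delta_mx 0 i) G x j l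
  + 'D_(delta_mx 0 j) G x i l - 'D_(delta_mx 0 l) G x i j.
have Gi i j : invmx (G x) i j = invmx (G x) j i.
  by rewrite -[in RHS]Gs -trmx_inv mxE.
pose s := \row_l \sum_i \sum_j t l i j * u 0 i * v 0 j.
have -> : christoffel_form G x u v = 2^-1 *: (s *m invmx (G x)).
  apply/rowP => k; rewrite !mxE mulr_sumr.
  under [RHS]eq_bigr do rewrite mxE mulr_suml mulr_sumr.
  rewrite [RHS]exchange_big; apply: eq_bigr => i _.
  under [RHS]eq_bigr do rewrite mulr_suml mulr_sumr.
  rewrite [RHS]exchange_big; apply: eq_bigr => j _.
  rewrite /christoffel mulr_sumr !mulr_suml; apply: eq_bigr => l _.
  rewrite (Gi k) /t; ring.
rewrite /inner -!scalemxAl mulmxKV// !mxE; congr (_ * _).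
under eq_bigr do rewrite !mxE mulr_suml.
rewrite exchange_big; apply: eq_bigr => i _.
under eq_bigr do rewrite mulr_suml.
by rewrite exchange_big.
Qed.

Lemma derive_gram_sym (x v : vec) i j : differentiable G x ->
  (\forall y \near x, (G y)^T = G y) -> 'D_v G x i j = 'D_v G x j i.
Proof.
move=> dG Gs; have dGv := @diff_derivable _ _ _ _ _ v dG.
rewrite derive_mx// !mxE; apply: near_eq_derive.
by apply: filterS Gs => y Gy; rewrite -[in LHS]Gy mxE.
Qed.

Lemma derive_gram (x v : vec) : differentiable G x ->
  'D_v G x = \sum_l v 0 l *: 'D_(delta_mx 0 l) G x.
Proof.
move=> dG; rewrite deriveE// {1}(row_sum_delta v) linear_sum; apply: eq_bigr => l _.
by rewrite linearZ deriveE.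
Qed.

Lemma nabla_torsion_free (X Y : vec -> vec) (x : vec) : differentiable G x ->
  (\forall y \near x, (G y)^T = G y) ->
  nabla G X Y x - nabla G Y X x = bracket X Y x.
Proof.
move=> dG Gs.
have csym : christoffel_form G x (Y x) (X x) = christoffel_form G x (X x) (Y x).
  apply/rowP => k; rewrite !mxE exchange_big.
  apply: eq_bigr => i _; apply: eq_bigr => j _; rewrite mulrAC; congr (_ * _ * _).
  congr (_ * _); apply: eq_bigr => l _; congr (_ * _).
  by rewrite (addrC ('D__ G x j l)) (derive_gram_sym _ j i).
by rewrite /nabla /bracket csym opprD addrACA addrN addr0.
Qed.

Lemma nabla_metric (X Y Z : vec -> vec) (x : vec) : differentiable G x ->
  G x \in unitmx -> (\forall y \near x, (G y)^T = G y) ->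
  differentiable Y x -> differentiable Z x ->
  'D_(X x) (fun y => inner (G y) (Y y) (Z y)) x
  = inner (G x) (nabla G X Y x) (Z x) + inner (G x) (Y x) (nabla G X Z x).
Proof.
move=> dG Gu Gs dY dZ; have Gsx := nbhs_singleton Gs.
have innerC u v : inner (G x) u v = inner (G x) v u.
  by rewrite /inner -[RHS]trace_mx11 -mxtrace_tr !trmx_mul trmxK Gsx mulmxA trace_mx11.
have innerDl u v w : inner (G x) (u + v) w = inner (G x) u w + inner (G x) v w.
  by rewrite /inner !mulmxDl mxE.
rewrite derive_inner; try exact: diff_derivable.
rewrite /nabla innerDl (innerC (Y x) (_ + _)) innerDl !inner_christoffel// (innerC ('D_(X x) Z x)).
rewrite [RHS]addrACA -[LHS]addrA [LHS]addrC; congr (_ + _).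
rewrite -mulrDr derive_gram// innerE -big_split/=.
under [in RHS]eq_bigr => i _.
  rewrite [X in _ + X]exchange_big -big_split.
  under eq_bigr => j _ do rewrite -big_split.
  over.
under eq_bigr => j _.
  under eq_bigr => l _ do rewrite summxE !mulr_suml.
  rewrite exchange_big; over.
rewrite exchange_big mulr_sumr; apply: eq_bigr => i _ /=.
rewrite mulr_sumr; apply: eq_bigr => j _.
rewrite mulr_sumr; apply: eq_bigr => l _.
by rewrite mxE (derive_gram_sym _ l j)//; field.
Qed.
End LeviCivita.

(* [coord a] and [param a] are mutually inverse homeomorphisms between [dom a]
   and its image; their values elsewhere are irrelevant. *)
Record manifold (R : realType) (m : nat) := Manifold {
  carrier :> topologicalType;
  chart : Type;
  dom : chart -> set carrier;
  coord : chart -> carrier -> 'rV[R]_m;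
  param : chart -> 'rV[R]_m -> carrier;
  manifold_hausdorff : hausdorff_space carrier;
  manifold_second_countable : @second_countable carrier;
  chart_cover : forall p, exists a, dom a p;
  dom_open : forall a, open (dom a);
  codom_open : forall a, open (coord a @` dom a);
  coordK : forall a p, dom a p -> param a (coord a p) = p;
  coord_continuous : forall a, {within dom a, continuous (coord a)};
  param_continuous : forall a, {within coord a @` dom a, continuous (param a)};
  transition_smooth : forall a b,
    smooth_on (coord a @` (dom a `&` dom b)) (coord b \o param a)
}.

Section Manifold.
Variables (R : realType) (m : nat) (M : manifold R m).
Notation vec := 'rV[R]_m.

Definition codom (a : chart M) : set vec := coord a @` dom a.

Definition overlap (a b : chart M) : set vec := coord a @` (dom a `&` dom b).

Definition transition (a b : chart M) : vec -> vec := coord b \o param a.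

Record riemannian_metric := RiemannianMetric {
  gram :> chart M -> vec -> 'M[R]_m;
  gram_smooth : forall a, smooth_on (codom a) (gram a);
  gram_transition : forall a b x, overlap a b x ->
    gram a x = 'J (transition a b) x *m gram b (transition a b x)
               *m ('J (transition a b) x)^T;
  gram_sym : forall a x, codom a x -> (gram a x)^T = gram a x;
  gram_pos : forall a x u, codom a x -> u != 0 -> 0 < inner (gram a x) u u
}.

End Manifold.

(* In a chart, phi(u) = u *m phi a x and eta(u) = (u *m eta a x) 0 0.
   Vector fields are taken on the domains of the charts, all the identities
   being local. *)
Record contact_metric (R : realType) (n : nat) (N : manifold R n.*2.+1) :=
  ContactMetric {
  metric : riemannian_metric N;
  phi : chart N -> 'rV[R]_n.*2.+1 -> 'M[R]_n.*2.+1;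
  xi : chart N -> 'rV[R]_n.*2.+1 -> 'rV[R]_n.*2.+1;
  eta : chart N -> 'rV[R]_n.*2.+1 -> 'cV[R]_n.*2.+1;
  phi_smooth : forall a, smooth_on (codom a) (phi a);
  xi_smooth : forall a, smooth_on (codom a) (xi a);
  eta_smooth : forall a, smooth_on (codom a) (eta a);
  phi_transition : forall a b x, overlap a b x ->
    phi a x *m 'J (transition a b) x
    = 'J (transition a b) x *m phi b (transition a b x);
  xi_transition : forall a b x, overlap a b x ->
    xi b (transition a b x) = xi a x *m 'J (transition a b) x;
  eta_transition : forall a b x, overlap a b x ->
    eta a x = 'J (transition a b) x *m eta b (transition a b x);
  phi_phi : forall a x u, codom a x ->
    u *m phi a x *m phi a x = - u + (u *m eta a x) 0 0 *: xi a x;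
  eta_xi : forall a x, codom a x -> (xi a x *m eta a x) 0 0 = 1;
  metric_phi : forall a x u v, codom a x ->
    inner (metric a x) (u *m phi a x) (v *m phi a x)
    = inner (metric a x) u v - (u *m eta a x) 0 0 * (v *m eta a x) 0 0;
  (* g(X, phi Y) = d eta(X, Y), where
     d eta(X, Y) = (X eta(Y) - Y eta(X) - eta([X, Y])) / 2 *)
  metric_deta : forall a (X Y : 'rV[R]_n.*2.+1 -> 'rV[R]_n.*2.+1) x,
    smooth_on (codom a) X -> smooth_on (codom a) Y -> codom a x ->
    inner (metric a x) (X x) (Y x *m phi a x)
    = 2^-1 * ('D_(X x) (fun y => (Y y *m eta a y) 0 0) x
              - 'D_(Y x) (fun y => (X y *m eta a y) 0 0) x
              - (bracket X Y x *m eta a x) 0 0)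
}.

Section Sasakian.
Variables (R : realType) (n : nat) (N : manifold R n.*2.+1).
Variable S : contact_metric N.
Notation vec := 'rV[R]_n.*2.+1.
Notation g := (metric S).

(* (nabla_X phi) Y = nabla_X (phi Y) - phi (nabla_X Y) *)
Definition sasakian := forall a (X Y : vec -> vec) x,
  smooth_on (codom a) X -> smooth_on (codom a) Y -> codom a x ->
  nabla (g a) X (fun y => Y y *m phi S a y) x - nabla (g a) X Y x *m phi S a x
  = inner (g a x) (X x) (Y x) *: xi S a x - (Y x *m eta S a x) 0 0 *: X x.

Definition constant_phi_sectional_curvature (c : R) :=
  forall a x u, codom a x -> inner (g a x) u u = 1 -> (u *m eta S a x) 0 0 = 0 ->
  sectional_curvature (g a) x u (u *m phi S a x) = c.

Definition sasakian_space_form (c : R) :=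
  sasakian /\ constant_phi_sectional_curvature c.

End Sasakian.

Section Curves.
Variables (R : realType) (m : nat) (M : manifold R m).
Variables (I : set R) (gam : R -> M).
Notation vec := 'rV[R]_m.

Definition curve_dom (a : chart M) : set R := [set t | I t /\ dom a (gam t)].

Definition local_curve (a : chart M) : R -> vec := fun t => coord a (gam t).

Definition smooth_curve :=
  (forall t, I t -> {for t, continuous gam}) /\
  (forall a, smooth_on (curve_dom a) (local_curve a)).

(* [E a t]: components in the chart [a] of a tangent vector at [gam t]. *)
Definition along := chart M -> R -> vec.

Definition vector_field_along (E : along) :=
  (forall a, smooth_on (curve_dom a) (E a)) /\
  (forall a b t, curve_dom a t -> curve_dom b t ->
     E b t = E a t *m 'J (transition a b) (local_curve a t)).

Definition velocity : along := fun a t => derive1 (local_curve a) t.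

Variable g : riemannian_metric M.

Definition covariant_derivative (E : along) : along := fun a t =>
  derive1 (E a) t + christoffel_form (g a) (local_curve a t) (velocity a t) (E a t).

Definition inner_along (E F : along) (a : chart M) (t : R) : R :=
  inner (g a (local_curve a t)) (E a t) (F a t).

(* The frame is [E 1, ..., E r] and the curvatures are [kappa 1, ..., kappa r.-1];
   the other values of [E] and [kappa] are irrelevant.  Arc length
   parametrization is contained in [E 1 = velocity] and orthonormality. *)
Definition frenet_curve (r : nat) (E : nat -> along) (kappa : nat -> R -> R) :=
  [/\ smooth_curve /\ (1 <= r <= m)%N,
      forall i, (1 <= i <= r)%N -> vector_field_along (E i),
      forall i, (1 <= i < r)%N ->
        smooth_on I (kappa i) /\ (forall t, I t -> 0 < kappa i t) &
      forall a t, curve_dom a t ->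
      [/\ E 1%N a t = velocity a t,
          forall i j, (1 <= i <= r)%N -> (1 <= j <= r)%N ->
            inner_along (E i) (E j) a t = (i == j)%:R &
          forall i, (1 <= i <= r)%N ->
            covariant_derivative (E i) a t
            = (if (1 < i)%N then - (kappa i.-1 t *: E i.-1 a t) else 0)
              + (if (i < r)%N then kappa i t *: E i.+1 a t else 0)]].

Definition constant_on (f : R -> R) := exists k, forall t, I t -> f t = k.

Definition circle E kappa := frenet_curve 2 E kappa /\ constant_on (kappa 1%N).

Definition helix E kappa :=
  [/\ frenet_curve 3 E kappa, constant_on (kappa 1%N) & constant_on (kappa 2)].

Definition tension : along := covariant_derivative velocity.

Definition bitension : along := fun a t =>
  covariant_derivative (covariant_derivative tension) a t
  - curvature_at (g a) (local_curve a t)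
      (velocity a t) (tension a t) (velocity a t).

Definition harmonic := forall a t, curve_dom a t -> tension a t = 0.

Definition biharmonic := forall a t, curve_dom a t -> bitension a t = 0.

Definition proper_biharmonic := biharmonic /\ ~ harmonic.

End Curves.

Section CurvesInContactManifolds.
Variables (R : realType) (n : nat) (N : manifold R n.*2.+1).
Variables (S : contact_metric N) (I : set R) (gam : R -> N).

(* eta(T) *)
Definition eta_velocity (a : chart N) (t : R) : R :=
  (velocity gam a t *m eta S a (local_curve gam a t)) 0 0.

Definition legendre := forall a t, curve_dom I gam a t -> eta_velocity a t = 0.

Definition tension_orth_phi_velocity := forall a t, curve_dom I gam a t ->
  inner (metric S a (local_curve gam a t)) (tension gam (metric S) a t)
    (velocity gam a t *m phi S a (local_curve gam a t)) = 0.

End CurvesInContactManifolds.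

(* Main.v *)
Require Import Defs.
From mathcomp Require Import all_boot all_order all_algebra.
From mathcomp Require Import all_classical all_reals all_analysis.
From mathcomp Require Import ring lra.
Set Implicit Arguments.
Unset Strict Implicit.
Unset Printing Implicit Defensive.
Import Order.TTheory GRing.Theory Num.Theory.
Import numFieldNormedType.Exports.
Local Open Scope classical_set_scope.
Local Open Scope ring_scope.

(** A Sasakian space form has R(T, X)T = -(c+3)/4 X
    + (c-1)/4 (eta(T)^2 X - eta(T) eta(X) T + eta(X) xi) for X orthogonal to T and phi T:
    the difference S between its curvature tensor and the expected one is a Kaehler-like
    curvature tensor with vanishing holomorphic sectional curvature, and polarizing
    S(x, phi x, phi x, x) = 0 gives S(x, z)x = 0.

    Put k = (c-1)/4, f = eta(T), a = eta(E_2), V = nabla_T E_2 + kappa_1 T and b = eta(V).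
    Then f' = kappa_1 a and a' = b - kappa_1 f, and differentiating g(E_2, phi T) = 0
    yields g(V, phi T) = -a.  For a biharmonic curve the component along T
    gives kappa_1' = 0, and then nabla_T V is determined by the equation: b' = kappa_1^2 a,
    (|V|^2)' = 2k a b and |V|^2 = 1 + k - kappa_1^2 - k (f^2 + a^2).  Differentiating the last
    identity, (|V|^2)' = -2k a b, so that a b = 0; differentiating a b = 0 once more
    forces a = 0.  Hence f is constant, |V| is constant and nabla_T V = -|V|^2 E_2, which
    leaves only circles and helices. *)

(** Derivatives and Christoffel terms become variables, so that entrywise [ring] meets only
    atoms. *)
Ltac generalize_vectors :=
  repeat match goal with |- context [derive ?f ?x ?v] => generalize (derive f x v); intro end;
  repeat match goal with
    |- context [christoffel_form ?G ?x ?u ?v] => generalize (christoffel_form G x u v); intro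
  end.

Ltac generalize_inner :=
  repeat match goal with |- context [inner ?A ?u ?v] => generalize (inner A u v); intro end.

(** * Curvature-like tensors *)

Section KaehlerCurvature.
Variables (R : realFieldType) (V : lmodType R).
Variables (S : V -> V -> V -> V -> R) (J : V -> V).
Hypothesis S_lin : forall k x y z w t, S (k *: x + y) z w t = k * S x z w t + S y z w t.
Hypothesis S_alt : forall x y z w, S x y z w = - S y x z w.
Hypothesis S_skew : forall x y z w, S x y z w = - S x y w z.
Hypothesis S_pair : forall x y z w, S x y z w = S z w x y.
Hypothesis S_bianchi : forall x y z w, S x y z w + S y z x w + S z x y w = 0.
Hypothesis J_lin : forall k x y, J (k *: x + y) = k *: J x + J y.
Hypothesis S_J : forall x y z w, S x y (J z) w = - S x y z (J w).
(** The intended [J] satisfies J^2 = -I + eta xi rather than J^2 = -I. Since the intended [S]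
    vanishes on xi, J^2 acts as -I inside [S], and only this is assumed. *)
Hypothesis S_JJ : forall x y z w, S x y (J (J z)) w = - S x y z w.
Hypothesis S_hol : forall x, S x (J x) (J x) x = 0.

Let lin2 k x y z w t : S z (k *: x + y) w t = k * S z x w t + S z y w t.
Proof. by rewrite S_alt S_lin (S_alt z x) (S_alt z y); ring. Qed.

Let lin3 k x y z w t : S z w (k *: x + y) t = k * S z w x t + S z w y t.
Proof. by rewrite S_pair S_lin -!(S_pair z). Qed.

Let lin4 k x y z w t : S z w t (k *: x + y) = k * S z w t x + S z w t y.
Proof. by rewrite S_pair lin2 -!(S_pair z). Qed.

Let lin := (J_lin, S_lin, lin2, lin3, lin4).

Let J12 x y z w : S (J x) y z w = - S x (J y) z w.
Proof. by rewrite S_pair S_J !(S_pair z). Qed.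

Let S_hol_polar x y : S x (J x) (J x) y = 0.
Proof.
have E1 : S y (J x) (J x) x = S x (J x) (J x) y by rewrite S_pair S_alt S_skew opprK.
have E2 : S x (J y) (J x) x = S x (J x) (J x) y by rewrite S_pair S_alt S_J.
have E3 : S x (J x) (J y) x = S x (J x) (J x) y by rewrite S_skew S_J.
(* The coefficient of k in this quartic polynomial is 4 S(x, Jx, Jx, y). *)
have H k := S_hol (k *: y + x).
have := H 1; have := H (-1); have := H 2.
rewrite !lin !S_hol E1 E2 E3; lra.
Qed.

(** Put A(z, w) = S(x, z, x, w). Polarization and the Bianchi identity give 3 A(J z, w) = A(z, J w);
    applying this at (J z, w) and at (z, J w) yields 9 A(z, w) = A(z, w). *)
Lemma kaehler_curvature_eq0 x z w : S x z x w = 0.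
Proof.
have P x' w' : S x' (J x') x' w' = 0.
  by apply/oppr_inj; rewrite -S_JJ S_J S_hol_polar oppr0.
have J21 x' y' z' w' : S x' (J y') z' w' = S y' (J x') z' w'.
  by rewrite S_alt J12 opprK.
(* The coefficient of k in S(k z' + x, J(k z' + x), k z' + x, w') = 0, isolated by the values at 1
   and -1 because the cubic coefficient vanishes by [P]. Two of its three terms agree by [J21]. *)
have D z' w' : 2 * S x (J z') x w' + S x (J x) z' w' = 0.
  have H k := P (k *: z' + x) w'.
  have := H 1; have := H (-1); have := J21 z' x x w'.
  by rewrite !lin !P; lra.
(* The Bianchi identity turns S(x, J x, z', w') into S(x, J z', x, w') - S(x, z', x, J w'). *)
have F z' w' : 3 * S x (J z') x w' = S x z' x (J w').
  have := S_bianchi x (J x) z' w'; have := D z' w'; have := J12 x z' x w'.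
  have := S_alt z' x (J x) w'; have := S_J x z' x w'; lra.
have := F (J z) w; have := F z (J w).
have -> : S x (J (J z)) x w = - S x z x w.
  by rewrite S_pair S_skew S_JJ -S_skew S_pair.
have -> : S x z x (J (J w)) = - S x z x w by rewrite S_skew S_JJ -S_skew.
by lra.
Qed.
End KaehlerCurvature.

(** Combine the four Bianchi identities in which each argument in turn stands in the last slot. The
    bare type [T] lets the result serve both the difference tensor and the Riemann tensor. *)
Lemma curvature_pair_sym (R : realFieldType) (T : Type) (S : T -> T -> T -> T -> R) :
  (forall x y z w, S x y z w = - S y x z w) ->
  (forall x y z w, S x y z w = - S x y w z) ->
  (forall x y z w, S x y z w + S y z x w + S z x y w = 0) ->
  forall x y z w, S x y z w = S z w x y.
Proof.
move=> alt skew bianchi x y z w.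
have := bianchi x y z w; have := bianchi y z w x.
have := bianchi z w x y; have := bianchi w x y z.
rewrite (skew y z w x) (skew z w y x) (skew x y w z) (skew w x y z).
rewrite (alt z x y w) (skew x z y w) (alt y w x z) (skew w y x z).
by lra.
Qed.

(** * Almost contact linear algebra and the curvature of Sasakian space forms *)

Section AlmostContact.
Variables (R : rcfType) (V : lmodType R).
Variables (g : V -> V -> R) (J : V -> V) (eta : V -> R) (xi : V).
Hypothesis g_lin : forall k x y z, g (k *: x + y) z = k * g x z + g y z.
Hypothesis g_sym : forall x y, g x y = g y x.
Hypothesis g_pos : forall x, x != 0 -> 0 < g x x.
Hypothesis J_lin : forall k x y, J (k *: x + y) = k *: J x + J y.
Hypothesis eta_lin : forall k x y, eta (k *: x + y) = k * eta x + eta y.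
Hypothesis J_J : forall x, J (J x) = - x + eta x *: xi.
Hypothesis eta_xi : eta xi = 1.
Hypothesis g_J : forall x y, g (J x) (J y) = g x y - eta x * eta y.

Lemma almost_contact_eta0 : eta 0 = 0.
Proof. by have := eta_lin (-1) 0 0; rewrite scaler0 addr0; lra. Qed.

Lemma almost_contact_g0 y : g 0 y = 0.
Proof. by have := g_lin (-1) 0 0 y; rewrite scaler0 addr0; lra. Qed.

Lemma almost_contact_J0 : J 0 = 0.
Proof. by have := J_lin (-1) 0 0; rewrite scaler0 addr0 scaleN1r addNr. Qed.

Let xi_neq0 : xi != 0.
Proof. by apply: contra_eq_neq eta_xi => ->; rewrite almost_contact_eta0 eq_sym oner_eq0. Qed.

Let JZ k x : J (k *: x) = k *: J x.
Proof. by rewrite -[k *: x]addr0 J_lin almost_contact_J0 !addr0. Qed.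

Let JN x : J (- x) = - J x.
Proof. by rewrite -scaleN1r JZ scaleN1r. Qed.

(** [J] kills J xi, so [J_J] at J xi makes it a multiple e xi; then 0 = J(J xi) = e^2 xi. *)
Lemma almost_contact_J_xi : J xi = 0.
Proof.
have JJxi : J (J xi) = 0 by rewrite J_J eta_xi scale1r addNr.
have [e E] : exists e, J xi = e *: xi.
  exists (eta (J xi)); have := J_J (J xi); rewrite JJxi almost_contact_J0.
  by move/eqP; rewrite eq_sym addrC subr_eq0 => /eqP.
have [e0|e0] := eqVneq e 0; first by rewrite E e0 scale0r.
move: JJxi; rewrite E JZ E scalerA => /eqP.
by rewrite scaler_eq0 mulf_eq0 (negbTE e0) (negbTE xi_neq0).
Qed.

(** Applying [J] to [J_J] gives J^3 = -J, while [J_J] at J x adds the term eta(J x) xi. *)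
Lemma almost_contact_eta_J x : eta (J x) = 0.
Proof.
have E : J (J (J x)) = - J x.
  by rewrite (J_J x) addrC J_lin JN almost_contact_J_xi scaler0 add0r.
move/eqP: E; rewrite J_J -subr_eq0 opprK addrAC addNr add0r scaler_eq0.
by rewrite (negbTE xi_neq0) orbF => /eqP.
Qed.

Lemma almost_contact_g_xi x : g xi x = eta x.
Proof.
have := g_J xi x; rewrite almost_contact_J_xi almost_contact_g0 eta_xi; lra.
Qed.

Lemma almost_contact_skew x y : g (J x) y = - g x (J y).
Proof.
have := g_J x (J y); rewrite J_J addrC (g_sym (J x)) g_lin almost_contact_g_xi.
rewrite -scaleN1r -[X in g X]addr0 g_lin almost_contact_g0 !almost_contact_eta_J.
by rewrite (g_sym y); lra.
Qed.

Variable Rm : V -> V -> V -> V -> R.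
Hypothesis Rm_lin : forall k x y z w t, Rm (k *: x + y) z w t = k * Rm x z w t + Rm y z w t.
Hypothesis Rm_alt : forall x y z w, Rm x y z w = - Rm y x z w.
Hypothesis Rm_skew : forall x y z w, Rm x y z w = - Rm x y w z.
Hypothesis Rm_bianchi : forall x y z w, Rm x y z w + Rm y z x w + Rm z x y w = 0.
Hypothesis Rm_xi : forall x y w, Rm x y xi w = eta y * g x w - eta x * g y w.
(** The commutator of the curvature with phi on a Sasakian manifold, with [J] moved onto w by
    skewness. *)
Hypothesis Rm_J : forall x y z w,
  Rm x y (J z) w + Rm x y z (J w)
  = - g y z * g (J x) w + g (J x) z * g y w + g x z * g (J y) w - g (J y) z * g x w.
Variable c : R.
Hypothesis Rm_hol : forall u, g u u = 1 -> eta u = 0 -> Rm u (J u) (J u) u = c.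

Let k := (c - 1) / 4.

(* The curvature tensor of a Sasakian space form. *)
Let R0 x y z w :=
  (k + 1) * (g z y * g x w - g z x * g y w)
  + k * (eta z * eta x * g y w - eta z * eta y * g x w
         + g z x * eta y * eta w - g z y * eta x * eta w
         + g z (J y) * g (J x) w - g z (J x) * g (J y) w + 2 * (g x (J y) * g (J z) w)).

Let S x y z w := Rm x y z w - R0 x y z w.

Let g_linr a x y z : g z (a *: x + y) = a * g z x + g z y.
Proof. by rewrite g_sym g_lin !(g_sym _ z). Qed.

Let gJx x : g x (J x) = 0.
Proof. by have := almost_contact_skew x x; rewrite g_sym; lra. Qed.

Let gJ_anti x y : g x (J y) = - g y (J x).
Proof. by rewrite g_sym almost_contact_skew. Qed.

Let S_lin a x y z w t : S (a *: x + y) z w t = a * S x z w t + S y z w t.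
Proof. by rewrite /S /R0 Rm_lin !J_lin !g_lin !g_linr !eta_lin; ring. Qed.

Let S_alt x y z w : S x y z w = - S y x z w.
Proof. by rewrite /S /R0 Rm_alt (gJ_anti x y); ring. Qed.

Let S_skew x y z w : S x y z w = - S x y w z.
Proof.
rewrite /S /R0 Rm_skew !almost_contact_skew (gJ_anti x w) (gJ_anti y w).
by rewrite (gJ_anti x z) (gJ_anti y z) (gJ_anti w z) !(g_sym z) !(g_sym w); ring.
Qed.

Let S_bianchi x y z w : S x y z w + S y z x w + S z x y w = 0.
Proof.
rewrite -[RHS](Rm_bianchi x y z w) /S /R0 (gJ_anti z x) (gJ_anti z y) (gJ_anti y x).
by rewrite (g_sym z x) (g_sym z y) (g_sym y x); ring.
Qed.

Let S_pair := curvature_pair_sym S_alt S_skew S_bianchi.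

Let S_xi x y w : S x y xi w = 0.
Proof.
rewrite /S /R0 Rm_xi eta_xi almost_contact_J_xi almost_contact_g0.
by rewrite !almost_contact_g_xi !almost_contact_eta_J; ring.
Qed.

Let gNl x y : g (- x) y = - g x y.
Proof. by rewrite -[- x]addr0 -scaleN1r g_lin almost_contact_g0; ring. Qed.

(** At k = 0, [R0] is the tensor of constant curvature 1, which satisfies the identity [Rm_J]; the
    part of [R0] linear in k contributes 0 to that sum. *)
Let S_J x y z w : S x y (J z) w = - S x y z (J w).
Proof.
apply/eqP; rewrite -addr_eq0 /S addrACA Rm_J /R0 !almost_contact_eta_J J_J.
rewrite (addrC (- z)) g_lin gNl almost_contact_g_xi !g_J !almost_contact_skew.
rewrite ?(gJ_anti z x) ?(gJ_anti z y) ?(gJ_anti w x) ?(gJ_anti w y) ?(gJ_anti w z).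
rewrite ?(g_sym z x) ?(g_sym z y) ?(g_sym w x) ?(g_sym w y) ?(g_sym w z) /k.
by apply/eqP; field.
Qed.

Let S_0 y z w : S 0 y z w = 0.
Proof. by have := S_lin (-1) 0 0 y z w; rewrite scaler0 addr0; lra. Qed.

Let S_Z1 a x y z w : S (a *: x) y z w = a * S x y z w.
Proof. by rewrite -[a *: x]addr0 S_lin S_0 addr0. Qed.

Let S_JJ x y z w : S x y (J (J z)) w = - S x y z w.
Proof.
rewrite J_J addrC S_pair S_lin -S_pair S_xi mulr0 add0r.
by rewrite -scaleN1r S_Z1 mulN1r S_pair.
Qed.

(** [Rm_hol] speaks of unit vectors orthogonal to xi. Since [S] vanishes on xi, x may be replaced by
    its projection orthogonal to xi, whose squared length is |J x|^2; normalizing it to [u] only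
    rescales [S]. *)
Let S_hol x : S x (J x) (J x) x = 0.
Proof.
have [Jx0|Jx0] := eqVneq (J x) 0; first by rewrite Jx0 S_pair S_0.
have p0 : 0 < g x x - eta x ^+ 2 by rewrite expr2 -g_J g_pos.
have Sx y z w : S (- eta x *: xi + x) y z w = S x y z w.
  by rewrite S_lin S_pair S_xi mulr0 add0r.
pose s := (Num.sqrt (g x x - eta x ^+ 2))^-1.
have s0 : s != 0 by rewrite invr_eq0 sqrtr_eq0 -ltNge.
have ss : s * s * (g x x - eta x ^+ 2) = 1.
  by rewrite -[X in _ * X = 1](sqr_sqrtr (ltW p0)) /s; field; rewrite sqrtr_eq0 -ltNge.
pose u := s *: (- eta x *: xi + x).
have Ju : J u = s *: J x by rewrite JZ J_lin almost_contact_J_xi scaler0 add0r.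
have eu : eta u = 0.
  by rewrite /u -[s *: _]addr0 !eta_lin eta_xi almost_contact_eta0; ring.
have gu : g u u = 1.
  have gZ a y z : g (a *: y) z = a * g y z.
    by rewrite -[a *: y]addr0 g_lin almost_contact_g0 addr0.
  rewrite -ss /u gZ g_sym gZ g_lin almost_contact_g_xi g_linr (g_sym x xi).
  by rewrite almost_contact_g_xi eta_lin eta_xi; ring.
have : S u (J u) (J u) u = 0.
  rewrite /S (Rm_hol gu eu) /R0 (J_J u) eu scale0r addr0 (g_J u u) eu almost_contact_skew.
  by rewrite !(g_sym _ (- u)) !gNl gJx gu almost_contact_eta_J /k; field.
have Z2 a y z w t : S z (a *: y) w t = a * S z y w t.
  by rewrite S_alt S_Z1 (S_alt z y) mulrN.
rewrite Ju {1}/u S_Z1 Z2 Sx S_pair S_Z1 Z2 S_alt Sx -S_alt S_pair => /eqP.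
by rewrite ?mulf_eq0 !(negbTE s0) /= => /eqP.
Qed.

Lemma sasakian_space_form_curvature x z w : Rm x z x w =
  (k + 1) * (g x z * g x w - g x x * g z w)
  + k * (eta x ^+ 2 * g z w - eta x * eta z * g x w + g x x * eta z * eta w
         - g x z * eta x * eta w + 3 * (g x (J z) * g (J x) w)).
Proof.
have := kaehler_curvature_eq0 S_lin S_alt S_skew S_pair S_bianchi J_lin S_J S_JJ S_hol x z w.
by rewrite /S /R0 gJx => /eqP; rewrite subr_eq0 => /eqP ->; ring.
Qed.
End AlmostContact.

(** * Calculus of matrix-valued functions *)

Section MatrixCalculus.
Variables (R : realType) (V : normedModType R).
Implicit Types (x v : V).

Lemma is_derive_mxP m n (M : V -> 'M[R]_(m, n)) x v D :
  is_derive x v M D <-> forall i j, is_derive x v (fun y => M y i j) (D i j).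
Proof.
split=> [[dM <-] i j|dM].
  have dMij := (derivable_mxP M x v).1 dM i j.
  by rewrite derive_mx// mxE; exact: derivableP.
have dM' : derivable M x v by apply/derivable_mxP => i j; have [] := dM i j.
apply: DeriveDef => //; rewrite derive_mx//; apply/matrixP => i j.
by rewrite mxE; have [] := dM i j.
Qed.

Lemma is_derive_sum_fun (I : Type) (r : seq I) (P : pred I) (f : I -> V -> R)
    (df : I -> R) x v :
  (forall i, is_derive x v (f i) (df i)) ->
  is_derive x v (fun y => \sum_(i <- r | P i) f i y) (\sum_(i <- r | P i) df i).
Proof.
move=> dfi; elim: r => [|i r IH].
  by under eq_fun do rewrite big_nil; rewrite big_nil; exact: is_derive_cst.
rewrite big_cons; under eq_fun do rewrite big_cons.
by case: ifP => // _; exact: is_deriveD.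
Qed.

Lemma derivable_sum_fun (I : Type) (r : seq I) (P : pred I) (f : I -> V -> R) x v :
  (forall i, derivable (f i) x v) ->
  derivable (fun y => \sum_(i <- r | P i) f i y) x v.
Proof.
by move=> fx; have [] := is_derive_sum_fun r P (fun i => derivableP (fx i)).
Qed.

Lemma is_derive_mul_fun (f g : V -> R) x v df dg :
  is_derive x v f df -> is_derive x v g dg ->
  is_derive x v (fun y => f y * g y) (df * g x + f x * dg).
Proof.
move=> fx gx; apply: (@is_derive_eq _ _ _ (f * g)).
by rewrite addrC [df * _]mulrC.
Qed.

Lemma derivable_prod_fun (I : Type) (r : seq I) (f : I -> V -> R) x v :
  (forall i, derivable (f i) x v) -> derivable (fun y => \prod_(i <- r) f i y) x v.
Proof.
move=> dfi; elim: r => [|i r IH].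
  by under eq_fun do rewrite big_nil; exact: derivable_cst.
by under eq_fun do rewrite big_cons; exact: derivableM.
Qed.

Lemma is_derive_mulmx m n p (A : V -> 'M[R]_(m, n)) (B : V -> 'M[R]_(n, p)) x v dA dB :
  is_derive x v A dA -> is_derive x v B dB ->
  is_derive x v (fun y => A y *m B y) (dA *m B x + A x *m dB).
Proof.
move=> /is_derive_mxP Ax /is_derive_mxP Bx; apply/is_derive_mxP => i j.
under eq_fun do rewrite mxE.
rewrite !mxE -big_split /=; apply: is_derive_sum_fun => k.
exact: is_derive_mul_fun.
Qed.

Lemma is_derive_trmx m n (A : V -> 'M[R]_(m, n)) x v dA :
  is_derive x v A dA -> is_derive x v (fun y => (A y)^T) dA^T.
Proof.
move=> /is_derive_mxP Ax; apply/is_derive_mxP => i j.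
by under eq_fun do rewrite mxE; rewrite mxE.
Qed.

Lemma is_derive_scalemx m n (f : V -> R) (A : V -> 'M[R]_(m, n)) x v df dA :
  is_derive x v f df -> is_derive x v A dA ->
  is_derive x v (fun y => f y *: A y) (df *: A x + f x *: dA).
Proof.
move=> fx /is_derive_mxP Ax; apply/is_derive_mxP => i j.
by under eq_fun do rewrite mxE; rewrite !mxE; exact: is_derive_mul_fun.
Qed.

Lemma is_derive_inner m (A : V -> 'M[R]_m) (Y Z : V -> 'rV[R]_m) x v dA dY dZ :
  is_derive x v A dA -> is_derive x v Y dY -> is_derive x v Z dZ ->
  is_derive x v (fun y => inner (A y) (Y y) (Z y))
    (inner dA (Y x) (Z x) + inner (A x) dY (Z x) + inner (A x) (Y x) dZ).
Proof.
move=> Ax Yx Zx.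
have /is_derive_mxP/(_ 0 0) :=
  is_derive_mulmx (is_derive_mulmx Yx Ax) (is_derive_trmx Zx).
by rewrite [X in is_derive _ _ _ X]mxE mulmxDl [X in X + _]mxE [X in X + _]addrC.
Qed.

Lemma derivable_det n (A : V -> 'M[R]_n) x v :
  (forall i j, derivable (fun y => A y i j) x v) -> derivable (fun y => \det (A y)) x v.
Proof.
move=> Ax; rewrite /determinant.
apply: derivable_sum_fun => s; apply: derivableM; first exact: derivable_cst.
exact: derivable_prod_fun.
Qed.

(** Near x the inverse is the adjugate divided by the determinant, so its entries are rational
    functions of those of [A]. *)
Lemma derivable_invmx n (A : V -> 'M[R]_n) x v :
  derivable A x v -> (\forall y \near x, A y \in unitmx) ->
  derivable (fun y => invmx (A y)) x v.
Proof.
move=> /derivable_mxP Ax Au; have Aux := nbhs_singleton Au.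
apply/derivable_mxP => i j.
apply: (@near_eq_derivable _ _ _ (fun y => (\det (A y))^-1 * \adj (A y) i j)).
  by apply: filterS Au => y Ay; rewrite /invmx Ay [RHS]mxE.
apply: derivableM.
  by apply: derivableV; [rewrite -unitfE -unitmxE|exact: derivable_det].
under eq_fun do rewrite mxE /cofactor.
apply: derivableM; first exact: derivable_cst.
by apply: derivable_det => k l; under eq_fun do rewrite !mxE; exact: Ax.
Qed.

End MatrixCalculus.

(** * Smooth functions and the symmetry of second derivatives *)

Section Schwarz.
Variable R : realType.

Lemma derive_line (V W : normedModType R) (f : V -> W) x v :
  'D_v f x = 'D_1 (fun h : R => f (h *: v + x)) 0.
Proof.
rewrite /derive; set g1 := fun h => h^-1 *: _; set g2 := fun h => h^-1 *: _.
suff -> : g1 = g2 by []; apply/funext => h; rewrite /g1 /g2 /=.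
by rewrite addr0 scale0r add0r [_%:A]mulr1.
Qed.

(** [c] is only known to be derivable in the direction v. Restricted to the line through t it
    becomes a function of one real variable, for which derivable means differentiable, and
    differentials can be composed. *)
Lemma is_derive_chain (U V W : normedModType R) (c : U -> V) (f : V -> W) t v u :
  differentiable f (c t) -> is_derive t v c u ->
  is_derive t v (fun y => f (c y)) ('D_u f (c t)).
Proof.
move=> df [dc <-].
have dc0 := (derivable1_diffP _ _).1 ((derivable1P _ _ _).1 dc).
have df0 : differentiable f (c (0 *: v + t)) by rewrite scale0r add0r.
have dfc := differentiable_comp dc0 df0.
apply: DeriveDef; first exact: ((derivable1P _ _ _).2 ((derivable1_diffP _ _).2 dfc)).
rewrite derive_line (_ : (fun h : R => _) = f \o (fun h : R => c (h *: v + t)))//.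
by rewrite deriveE// (diff_comp dc0 df0)/= -deriveE// -deriveE// -derive_line scale0r add0r.
Qed.

Lemma is_derive_along_line (V W : normedModType R) (f : V -> W) w y (t : R) d :
  is_derive (t *: w + y) w f d -> is_derive t 1 (fun r : R => f (r *: w + y)) d.
Proof.
have rateE : (fun h => h^-1 *: (((fun r : R => f (r *: w + y)) \o shift t) (h *: 1)
      - f (t *: w + y)))
    = (fun h => h^-1 *: ((f \o shift (t *: w + y)) (h *: w) - f (t *: w + y))).
  by apply/funext => h /=; rewrite scalerDl [_%:A]mulr1 addrA.
by move=> [dg <-]; apply: DeriveDef; rewrite /derivable /derive rateE.
Qed.

Variables (V : normedModType R) (U : set V).
Hypothesis U_open : open U.

Lemma smooth_on_differentiable (W : normedModType R) (f : V -> W) x :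
  smooth_on U f -> U x -> differentiable f x.
Proof. by move=> sf; exact: (sf [::]). Qed.

Lemma smooth_on_derive (W : normedModType R) (f : V -> W) v :
  smooth_on U f -> smooth_on U ('D_v f).
Proof. by move=> sf s x Ux; have := sf (rcons s v) x Ux; rewrite foldr_rcons. Qed.

Lemma is_derive_smooth (W : normedModType R) (f : V -> W) v x :
  smooth_on U f -> U x -> is_derive x v f ('D_v f x).
Proof.
move=> sf Ux; apply: derivableP; apply: diff_derivable.
exact: smooth_on_differentiable.
Qed.

Lemma near_open (P : V -> Prop) x : U x -> (forall y, U y -> P y) -> \forall y \near x, P y.
Proof. by move=> Ux UP; apply: filterS (open_nbhs_nbhs (conj U_open Ux)). Qed.

Lemma derive_near_cst (W : normedModType R) (f : V -> W) (w : W) x v : U x ->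
  (forall y, U y -> f y = w) -> 'D_v f x = 0.
Proof.
by move=> Ux fw; rewrite (near_eq_derive v (near_open Ux fw)); exact: derive_cst.
Qed.

Lemma smooth_on_cst (W : normedModType R) (w : W) : smooth_on U (cst w : V -> W).
Proof.
move=> s x _; suff [w' ->] : exists w' : W, foldr (fun v h => 'D_v h) (cst w : V -> W) s = cst w'.
  exact: differentiable_cst.
elim: s => [|v s [w' /= ->]]; first by exists w.
by exists 0; apply/funext => y; exact: derive_cst.
Qed.

(** Two uses of the mean value theorem: along u for the increment [psi] of f in the direction v,
    then along v for [fu]. *)
Lemma second_difference_mean_value (f fu fuv : V -> R) x u v h : 0 < h ->
  (forall s t, 0 <= s <= h -> 0 <= t <= h -> U (s *: u + t *: v + x)) ->
  (forall y, U y -> is_derive y u f (fu y)) ->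
  (forall y, U y -> is_derive y v fu (fuv y)) ->
  exists s t, [/\ 0 < s < h, 0 < t < h &
    f (h *: u + h *: v + x) - f (h *: u + x) - f (h *: v + x) + f x
    = fuv (s *: u + t *: v + x) * h ^+ 2].
Proof.
move=> h0 Uh df ddf.
have h00 : 0 <= h <= h by rewrite ltW//=.
have h01 : 0 <= (0 : R) <= h by rewrite lexx ltW.
pose psi s := f (s *: u + (h *: v + x)) - f (s *: u + x).
have dpsi s : 0 <= s <= h ->
    is_derive s 1 psi (fu (s *: u + (h *: v + x)) - fu (s *: u + x)).
  move=> sh; apply: is_deriveB; apply: is_derive_along_line; apply: df.
    by rewrite addrA; exact: Uh.
  by have := Uh s 0 sh h01; rewrite scale0r addr0.
have itvW (s : R) : s \in `]0, h[ -> 0 <= s <= h.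
  by rewrite in_itv => /andP[/ltW -> /ltW ->].
have [|s sh Es] := @MVT _ psi _ _ _ h0 (fun s sh => dpsi s (itvW s sh)).
  apply: continuous_in_subspaceT => s; rewrite inE /= in_itv => sh.
  by apply/differentiable_continuous/derivable1_diffP; have [] := dpsi s sh.
pose chi t := fu (t *: v + (s *: u + x)).
have dchi t : 0 <= t <= h ->
    is_derive t 1 chi (fuv (t *: v + (s *: u + x))).
  move=> th; apply: is_derive_along_line; apply: ddf.
  by rewrite addrA (addrC (t *: v)); apply: Uh => //; exact: itvW.
have [|t th Et] := @MVT _ chi _ _ _ h0 (fun s sh => dchi s (itvW s sh)).
  apply: continuous_in_subspaceT => t; rewrite inE /= in_itv => th.
  by apply/differentiable_continuous/derivable1_diffP; have [] := dchi t th.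
exists s, t; split; [by rewrite in_itv in sh|by rewrite in_itv in th|].
move: Es Et; rewrite /psi /chi !subr0 !scale0r !add0r.
rewrite !addrA (addrC (t *: v)) (addrC (h *: v) (s *: u)) => Es Et.
rewrite -[X in _ = X * _]/(fuv (s *: u + t *: v + x)).
by move: Es; rewrite Et => Es; lra.
Qed.

(** The second difference is symmetric in u and v, so [fuv] and [fvu] take a common value at two
    points of a small parallelogram at x; continuity makes their values at x differ by at most any
    e. *)
Lemma Schwarz_scalar (f fu fv fuv fvu : V -> R) x u v : U x ->
  (forall y, U y -> is_derive y u f (fu y)) ->
  (forall y, U y -> is_derive y v f (fv y)) ->
  (forall y, U y -> is_derive y v fu (fuv y)) ->
  (forall y, U y -> is_derive y u fv (fvu y)) ->
  {for x, continuous fuv} -> {for x, continuous fvu} -> fuv x = fvu x.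
Proof.
move=> Ux dfu dfv dfuv dfvu /cvgrPdist_lt cuv /cvgrPdist_lt cvu.
apply/eqP; rewrite -subr_eq0 -normr_le0; apply/ler_addgt0Pr => e e0; rewrite add0r.
have e2 : 0 < e / 2 by rewrite divr_gt0.
have /nbhs_ballP[r /= r0 rU] : \forall y \near x,
    [/\ U y, `|fuv x - fuv y| < e / 2 & `|fvu x - fvu y| < e / 2].
  near=> y; split; near: y; [exact: open_nbhs_nbhs|exact: cuv|exact: cvu].
(* This side keeps the parallelogram inside the ball; the 1 avoids dividing by zero when u = v =
   0. *)
pose h := r / (`|u| + `|v| + 1).
have n0 : 0 < `|u| + `|v| + 1 by rewrite ltr_wpDl// addr_ge0.
have h0 : 0 < h by rewrite divr_gt0.
have inball s t : 0 <= s <= h -> 0 <= t <= h -> ball x r (s *: u + t *: v + x).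
  move=> /andP[s0 sh] /andP[t0 th].
  rewrite -ball_normE /= opprD addrCA subrr addr0 normrN.
  apply: le_lt_trans (ler_normD _ _) _; rewrite !normrZ !ger0_norm//.
  have : h * (`|u| + `|v| + 1) = r by rewrite /h divfK// gt_eqF.
  have := ler_wpM2r (normr_ge0 u) sh; have := ler_wpM2r (normr_ge0 v) th.
  by lra.
have W (s : R) : 0 < s < h -> 0 <= s <= h by move=> /andP[/ltW -> /ltW ->].
have [|s [t [/W sh /W th E1]]] := @second_difference_mean_value f fu fuv x u v h h0 _ dfu dfuv.
  by move=> s t sh th; have [] := rU _ (inball s t sh th).
have [|t' [s' [/W th' /W sh' E2]]] := @second_difference_mean_value f fv fvu x v u h h0 _ dfv dfvu.
  by move=> t' s' th' sh'; rewrite (addrC (t' *: v)); have [] := rU _ (inball s' t' sh' th').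
have [_ B1 _] := rU _ (inball s t sh th).
have [_ _ B2] := rU _ (inball s' t' sh' th').
have E : fuv (s *: u + t *: v + x) = fvu (t' *: v + s' *: u + x).
  apply: (@mulIf _ (h ^+ 2)); first by rewrite expf_neq0// gt_eqF.
  by rewrite -E1 -E2 (addrC (h *: u)); lra.
rewrite (addrC (s' *: u)) -E in B2.
have -> : fuv x - fvu x = (fuv x - fuv (s *: u + t *: v + x))
  - (fvu x - fuv (s *: u + t *: v + x)) by lra.
apply: le_trans (ler_normB _ _) _; lra.
Unshelve. all: by end_near. Qed.

Lemma Schwarz m n (F : V -> 'M[R]_(m, n)) x u v :
  smooth_on U F -> U x -> 'D_v ('D_u F) x = 'D_u ('D_v F) x.
Proof.
move=> sF Ux; apply/matrixP => i j.
have dE (F' : V -> 'M[R]_(m, n)) w y : smooth_on U F' -> U y ->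
    is_derive y w (fun z => F' z i j) ('D_w F' y i j).
  by move=> sF' Uy; exact: (is_derive_mxP _ _ _ _).1 (is_derive_smooth w sF' Uy) i j.
have cE w w' : {for x, continuous (fun z => 'D_w' ('D_w F) z i j)}.
  apply: differentiable_continuous.
  apply: (@differentiable_comp _ _ _ _ ('D_w' ('D_w F)) (fun M => M i j)).
    by apply: smooth_on_differentiable => //; do 2! apply: smooth_on_derive.
  exact: differentiable_coord.
have [sFu sFv] := (smooth_on_derive u sF, smooth_on_derive v sF).
exact: (Schwarz_scalar Ux (fun y => @dE _ u y sF) (fun y => @dE _ v y sF)
  (fun y => @dE _ v y sFu) (fun y => @dE _ u y sFv) (cE u v) (cE v u)).
Qed.
End Schwarz.

(** * Riemannian metrics in a chart *)

Section InnerProduct.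
Variables (R : realType) (m : nat).
Implicit Types (A : 'M[R]_m) (u v w : 'rV[R]_m).

Lemma inner_linl A k u v w : inner A (k *: u + v) w = k * inner A u w + inner A v w.
Proof. by rewrite /inner !mulmxDl -!scalemxAl !mxE. Qed.

Lemma inner_sym A u v : A^T = A -> inner A u v = inner A v u.
Proof.
by move=> As; rewrite /inner -[RHS]trace_mx11 -mxtrace_tr !trmx_mul trmxK As mulmxA trace_mx11.
Qed.

Lemma inner0l A w : inner A 0 w = 0.
Proof. by rewrite /inner !mul0mx mxE. Qed.

Lemma inner0r A u : inner A u 0 = 0.
Proof. by rewrite /inner trmx0 mulmx0 mxE. Qed.

Lemma innerDl A u v w : inner A (u + v) w = inner A u w + inner A v w.
Proof. by have := inner_linl A 1 u v w; rewrite scale1r mul1r. Qed.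

Lemma innerZl A k u w : inner A (k *: u) w = k * inner A u w.
Proof. by rewrite -[k *: u]addr0 inner_linl inner0l addr0. Qed.

Lemma innerNl A u w : inner A (- u) w = - inner A u w.
Proof. by rewrite -scaleN1r innerZl mulN1r. Qed.

Lemma inner_mulDl A (M : 'M[R]_m) u v w :
  inner A ((u + v) *m M) w = inner A (u *m M) w + inner A (v *m M) w.
Proof. by rewrite mulmxDl innerDl. Qed.

Lemma inner_mulNl A (M : 'M[R]_m) u w : inner A (- u *m M) w = - inner A (u *m M) w.
Proof. by rewrite mulNmx innerNl. Qed.

Definition inner_addl := (innerDl, innerZl, innerNl, inner_mulDl, inner_mulNl).
Lemma inner_posdef_unitmx A : (forall u, u != 0 -> 0 < inner A u u) -> A \in unitmx.
Proof.
move=> Apos; rewrite -row_free_unit -kermx_eq0; apply/negPn/rowV0Pn => -[u /sub_kermxP uA u0].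
by have := Apos u u0; rewrite /inner uA mul0mx mxE ltxx.
Qed.

Lemma inner_nondeg A u v : (forall u, u != 0 -> 0 < inner A u u) ->
  (forall w, inner A u w = inner A v w) -> u = v.
Proof.
move=> Apos uv; apply/eqP; rewrite -subr_eq0; apply: contraT => /Apos.
have E w : inner A (u - v) w = 0 by rewrite -scaleN1r addrC inner_linl uv mulN1r addNr.
by rewrite E ltxx.
Qed.
End InnerProduct.

Section RiemannianMetric.
Variables (R : realType) (m : nat).
Notation vec := 'rV[R]_m.
Variables (U : set vec) (G : vec -> 'M[R]_m).
Hypothesis U_open : open U.
Hypothesis G_smooth : smooth_on U G.
Hypothesis G_sym : forall x, U x -> (G x)^T = G x.
Hypothesis G_pos : forall x u, U x -> u != 0 -> 0 < inner (G x) u u.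
Notation Gam := (christoffel_form G).
Implicit Types (x u v w z : vec).

(** The connection matrix in the direction v. With it the Christoffel form is a matrix product, so
    that linearity and the product rule come from matrix calculus. *)
Definition christoffel_mx x v : 'M[R]_m :=
  \matrix_(j, k) \sum_i christoffel G x k i j * v 0 i.

Lemma christoffel_formE x v w : Gam x v w = w *m christoffel_mx x v.
Proof.
apply/rowP => l; rewrite !mxE exchange_big; apply: eq_bigr => j _ /=.
by rewrite !mxE mulr_sumr; apply: eq_bigr => i _; ring.
Qed.

Lemma christoffel_form_linr x k u v w : Gam x w (k *: u + v) = k *: Gam x w u + Gam x w v.
Proof. by rewrite !christoffel_formE mulmxDl -scalemxAl. Qed.

Let near_sym x : U x -> \forall y \near x, (G y)^T = G y.
Proof. by move=> Ux; exact: (near_open U_open Ux G_sym). Qed.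

Let G_diff x : U x -> differentiable G x.
Proof. exact: smooth_on_differentiable. Qed.

Let G_unit x : U x -> G x \in unitmx.
Proof. by move=> Ux; apply: inner_posdef_unitmx => u; exact: G_pos. Qed.

(** Torsion-freeness on constant fields, whose bracket vanishes. *)
Lemma christoffel_form_sym x u v : U x -> Gam x u v = Gam x v u.
Proof.
move=> Ux; have := nabla_torsion_free (cst u) (cst v) (G_diff Ux) (near_sym Ux).
rewrite /nabla /bracket !derive_cst !add0r oppr0 => /eqP.
by rewrite subr_eq0 => /eqP.
Qed.

Lemma derive_metric x u v w : U x ->
  inner ('D_u G x) v w = inner (G x) (Gam x u v) w + inner (G x) v (Gam x u w).
Proof.
move=> Ux.
have := @nabla_metric _ _ G (cst u) (cst v) (cst w) x (G_diff Ux) (G_unit Ux)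
  (near_sym Ux) (differentiable_cst _ _) (differentiable_cst _ _).
rewrite /nabla !derive_cst !add0r => <-.
have dv z : is_derive x u (fun=> z) (0 : vec) by exact: is_derive_cst.
have [_ ->] := is_derive_inner (is_derive_smooth u G_smooth Ux) (dv v) (dv w).
by rewrite inner0l inner0r !addr0.
Qed.

(* With [c] the inclusion of a chart or a curve, this covers both derivatives along vector
   fields and derivatives along curves. *)
Lemma is_derive_metric (V : normedModType R) (c : V -> vec) (Y Z : V -> vec) t e u dY dZ :
  U (c t) -> is_derive t e c u -> is_derive t e Y dY -> is_derive t e Z dZ ->
  is_derive t e (fun s => inner (G (c s)) (Y s) (Z s))
    (inner (G (c t)) (dY + Gam (c t) u (Y t)) (Z t)
     + inner (G (c t)) (Y t) (dZ + Gam (c t) u (Z t))).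
Proof.
move=> Uc dc dYt dZt.
have dG := is_derive_chain (G_diff Uc) dc.
apply: is_derive_eq (is_derive_inner dG dYt dZt) _.
rewrite (derive_metric _ _ _ Uc) -(scale1r dY) inner_linl.
rewrite (inner_sym (Y t) (dZ + _) (G_sym Uc)) -(scale1r dZ) inner_linl.
by rewrite !scale1r (inner_sym dZ _ (G_sym Uc)) (inner_sym (Gam _ _ (Z t)) _ (G_sym Uc)); ring.
Qed.

Lemma derivable_christoffel_mx x v w : U x -> derivable (christoffel_mx ^~ v) x w.
Proof.
move=> Ux; apply/derivable_mxP => j k; under eq_fun do rewrite mxE.
apply: derivable_sum_fun => i; apply: derivableM; last exact: derivable_cst.
apply: derivableM; first exact: derivable_cst.
have dinv : derivable (fun y => invmx (G y)) x w.
  apply: derivable_invmx; first exact/diff_derivable/G_diff.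
  by exact: (near_open U_open Ux G_unit).
apply: derivable_sum_fun => l; apply: derivableM.
  exact: (derivable_mxP _ _ _).1 dinv _ _.
have dd a b d : derivable (fun y => 'D_(delta_mx 0 a) G y b d) x w.
  have [dG _] := is_derive_smooth w (smooth_on_derive (delta_mx 0 a) G_smooth) Ux.
  exact: (derivable_mxP _ _ _).1 dG _ _.
by apply: derivableB => //; apply: derivableD.
Qed.

Lemma is_derive_christoffel_form x u v (Z : vec -> vec) dZ : U x ->
  is_derive x u Z dZ ->
  is_derive x u (fun y => Gam y v (Z y)) ('D_u (fun y => Gam y v (Z x)) x + Gam x v dZ).
Proof.
move=> Ux dZx; have dM := derivableP (@derivable_christoffel_mx x v u Ux).
under eq_fun do rewrite christoffel_formE.
apply: is_derive_eq (is_derive_mulmx dZx dM) _.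
under [in RHS]eq_fun do rewrite christoffel_formE.
have [_ ->] := is_derive_mulmx (@is_derive_cst _ _ _ (Z x) x u) dM.
by rewrite mul0mx add0r christoffel_formE addrC.
Qed.

Lemma is_derive_christoffel_form_cst x u v w : U x ->
  is_derive x u (fun y => Gam y v w) ('D_u (fun y => Gam y v w) x).
Proof.
move=> Ux; have dM := derivableP (@derivable_christoffel_mx x v u Ux).
apply: derivableP; under eq_fun do rewrite christoffel_formE.
by have [] := is_derive_mulmx (@is_derive_cst _ _ _ w x u) dM.
Qed.

Lemma curvature_atE x u v w : curvature_at G x u v w =
  'D_u (fun y => Gam y v w) x + Gam x u (Gam x v w)
  - ('D_v (fun y => Gam y u w) x + Gam x v (Gam x u w)).
Proof.
rewrite /curvature_at /curvature /bracket.
have -> : nabla G (cst v) (cst w) = fun y => Gam y v w.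
  by apply/funext => y; rewrite /nabla derive_cst add0r.
have -> : nabla G (cst u) (cst w) = fun y => Gam y u w.
  by apply/funext => y; rewrite /nabla derive_cst add0r.
rewrite /nabla !derive_cst subrr add0r.
have -> : Gam x 0 (cst w x) = 0.
  apply/rowP => k; rewrite !mxE big1// => i _; rewrite big1// => j _.
  by rewrite mxE mulr0 mul0r.
by rewrite subr0.
Qed.

(** [P] and [Q] are closed expressions for the covariant derivatives of [Z] along the constant
    fields v and u, differentiated in place of the originals. Both mixed second derivatives are the
    single value [Zuv]; the Schwarz theorem supplies this when the lemma is applied. *)
Lemma ricci_identity x u v (Z Zu Zv P Q : vec -> vec) Zuv dP dQ : U x ->
  (forall y, U y -> is_derive y u Z (Zu y)) -> (forall y, U y -> is_derive y v Z (Zv y)) ->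
  is_derive x u Zv Zuv -> is_derive x v Zu Zuv ->
  (forall y, U y -> Zv y + Gam y v (Z y) = P y) ->
  (forall y, U y -> Zu y + Gam y u (Z y) = Q y) ->
  is_derive x u P dP -> is_derive x v Q dQ ->
  curvature_at G x u v (Z x) = dP + Gam x u (P x) - (dQ + Gam x v (Q x)).
Proof.
move=> Ux dZu dZv dZvu dZuv EP EQ dPx dQx.
have dPE : Zuv + ('D_u (fun y => Gam y v (Z x)) x + Gam x v (Zu x)) = dP.
  have [_ <-] := dPx.
  rewrite -(near_eq_derive u (near_open U_open Ux EP)).
  by have [_ ->] := is_deriveD dZvu (is_derive_christoffel_form v Ux (dZu x Ux)).
have dQE : Zuv + ('D_v (fun y => Gam y u (Z x)) x + Gam x u (Zv x)) = dQ.
  have [_ <-] := dQx.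
  rewrite -(near_eq_derive v (near_open U_open Ux EQ)).
  by have [_ ->] := is_deriveD dZuv (is_derive_christoffel_form u Ux (dZv x Ux)).
rewrite curvature_atE -dPE -dQE -EP// -EQ//.
rewrite -(scale1r (Zv x)) -(scale1r (Zu x)) !christoffel_form_linr !scale1r.
by generalize_vectors; apply/rowP => k; rewrite !mxE; ring.
Qed.

Notation Rm x u v w z := (inner (G x) (curvature_at G x u v w) z).

Lemma curvature_atNl x u v w : curvature_at G x u v w = - curvature_at G x v u w.
Proof. by rewrite !curvature_atE opprB. Qed.

Lemma curvature_at_linr x k u v w w' : U x ->
  curvature_at G x u v (k *: w + w') = k *: curvature_at G x u v w + curvature_at G x u v w'.
Proof.
have D a b : U x -> 'D_a (fun y => Gam y b (k *: w + w')) x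
    = k *: 'D_a (fun y => Gam y b w) x + 'D_a (fun y => Gam y b w') x.
  move=> Ux; have H z := is_derive_christoffel_form_cst a b z Ux.
  under eq_fun do rewrite christoffel_form_linr.
  have [_ ->] := is_deriveD (is_deriveZ k (H w)) (H w').
  by [].
move=> Ux; rewrite !curvature_atE !D// !christoffel_form_linr.
by generalize_vectors; apply/rowP => i; rewrite !mxE; ring.
Qed.

Lemma curvature_at_bianchi x u v w : U x ->
  curvature_at G x u v w + curvature_at G x v w u + curvature_at G x w u v = 0.
Proof.
move=> Ux.
have symD a b d : 'D_a (fun y => Gam y b d) x = 'D_a (fun y => Gam y d b) x.
  by apply: near_eq_derive; apply: (near_open U_open Ux) => y; exact: christoffel_form_sym.
rewrite !curvature_atE (symD u w v) (symD v w u) (symD w v u).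
rewrite (christoffel_form_sym w v)// (christoffel_form_sym w u)// (christoffel_form_sym v u)//.
by generalize_vectors; apply/rowP => i; rewrite !mxE; ring.
Qed.

(** Expand the second derivative of g(w, z) along u and v, with w and z constant. The products of
    two first covariant derivatives are symmetric in u and v, so the Schwarz theorem leaves g(R(u,
    v)w, z) + g(w, R(u, v)z) = 0. *)
Lemma curvature_at_skew x u v w z : U x ->
  inner (G x) (curvature_at G x u v w) z = - inner (G x) (curvature_at G x u v z) w.
Proof.
move=> Ux; pose T a b := inner (G x) (Gam x a (Gam x b w)) z.
have D2 a b : inner ('D_a ('D_b G) x) w z =
    inner (G x) ('D_a (fun y => Gam y b w) x + Gam x a (Gam x b w)) z
    + inner (G x) (Gam x b w) (Gam x a z)
    + (inner (G x) (Gam x a w) (Gam x b z)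
    + inner (G x) w ('D_a (fun y => Gam y b z) x + Gam x a (Gam x b z))).
  have H z' := is_derive_christoffel_form_cst a b z' Ux.
  have C z' : is_derive x a (fun=> z' : vec) (0 : vec) by exact: is_derive_cst.
  have [_ E] := is_derive_inner (is_derive_smooth a (smooth_on_derive b G_smooth) Ux) (C w) (C z).
  rewrite inner0l inner0r !addr0 in E.
  rewrite -E.
  have -> : 'D_a (fun y => inner ('D_b G y) w z) x =
    'D_a (fun y => inner (G y) (Gam y b w) z + inner (G y) w (Gam y b z)) x.
    by apply: near_eq_derive; apply: (near_open U_open Ux) => y; exact: derive_metric.
  have Mid : is_derive x a id (a : vec) by exact: is_derive_id.
  have [_ ->] := is_deriveD (is_derive_metric Ux Mid (H w) (C z)) (is_derive_metric Ux Mid (C w) (H z)).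
  by rewrite !add0r.
have := D2 u v; rewrite (Schwarz U_open _ _ G_smooth Ux) D2 => E.
apply/eqP; rewrite -addr_eq0 (inner_sym _ w (G_sym Ux)) !curvature_atE.
have lin a b d : inner (G x) (a - b) d = inner (G x) a d - inner (G x) b d.
  by rewrite -scaleN1r addrC inner_linl; ring.
rewrite lin (inner_sym w _ (G_sym Ux)) lin !(inner_sym _ w (G_sym Ux)).
by apply/eqP; lra.
Qed.
End RiemannianMetric.

(** * Sasakian structures in a chart *)

Section SasakianChart.
Variables (R : realType) (n : nat) (N : manifold R n.*2.+1) (CM : contact_metric N).
Variable a : chart N.
Notation vec := 'rV[R]_n.*2.+1.
Notation U := (Defs.codom a).
Notation G := (metric CM a).
Notation Gam := (christoffel_form G).
Notation ph := (phi CM a).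
Notation eta_at x u := ((u *m eta CM a x) 0 0).
Implicit Types (x u v w z : vec).

Let U_open : open U := @codom_open _ _ _ a.
Let G_smooth : smooth_on U G := @gram_smooth _ _ _ (metric CM) a.
Let G_sym x : U x -> (G x)^T = G x := @gram_sym _ _ _ (metric CM) a x.
Let G_pos x u : U x -> u != 0 -> 0 < inner (G x) u u := @gram_pos _ _ _ (metric CM) a x u.

Let ph_lin x k u v : (k *: u + v) *m ph x = k *: (u *m ph x) + v *m ph x.
Proof. by rewrite mulmxDl scalemxAl. Qed.

Let eta_lin x k u v : eta_at x (k *: u + v) = k * eta_at x u + eta_at x v.
Proof. by rewrite mulmxDl -scalemxAl !mxE. Qed.

Section Point.
Variable x : vec.
Hypothesis Ux : U x.

Let J := fun u : vec => u *m ph x.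
Let et := fun u : vec => eta_at x u.
Let g := inner (G x).

Let g_lin : forall k u v w, g (k *: u + v) w = k * g u w + g v w := inner_linl (G x).
Let g_sym u v : g u v = g v u := inner_sym u v (G_sym Ux).
Let J_lin := ph_lin x.
Let et_lin := eta_lin x.
Let JJ u : J (J u) = - u + et u *: xi CM a x := phi_phi CM u Ux.
Let et_xi : et (xi CM a x) = 1 := eta_xi CM Ux.
Let g_J u v : g (J u) (J v) = g u v - et u * et v := metric_phi CM u v Ux.

Lemma phi_xi : xi CM a x *m ph x = 0.
Proof. exact: (almost_contact_J_xi J_lin et_lin JJ et_xi). Qed.

Lemma inner_xi u : inner (G x) (xi CM a x) u = eta_at x u.
Proof. exact: (almost_contact_g_xi g_lin J_lin et_lin JJ et_xi g_J). Qed.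

Lemma inner_phi u v : inner (G x) (u *m ph x) v = - inner (G x) u (v *m ph x).
Proof. exact: (almost_contact_skew g_lin g_sym J_lin et_lin JJ et_xi g_J). Qed.

End Point.

Hypothesis CM_sasakian : sasakian CM.

Lemma is_derive_phi x u : U x -> is_derive x u ph ('D_u ph x).
Proof. exact: is_derive_smooth (@phi_smooth _ _ _ CM a). Qed.

Lemma is_derive_xi x u : U x -> is_derive x u (xi CM a) ('D_u (xi CM a) x).
Proof. exact: is_derive_smooth (@xi_smooth _ _ _ CM a). Qed.

Lemma nabla_phi x u w : U x ->
  w *m 'D_u ph x + Gam x u (w *m ph x) - Gam x u w *m ph x
  = inner (G x) u w *: xi CM a x - eta_at x w *: u.
Proof.
move=> Ux.
have := CM_sasakian (smooth_on_cst u) (smooth_on_cst w) Ux.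
rewrite /nabla /= derive_cst add0r => <-.
have [_ ->] := is_derive_mulmx (@is_derive_cst _ _ _ w x u) (is_derive_phi u Ux).
by rewrite mul0mx add0r.
Qed.

(** Differentiating phi xi = 0 and using the Sasakian condition gives phi W = u - eta(u) xi for W =
    nabla_u xi. As xi has unit length, eta(W) = 0, and a second application of phi recovers W. *)
Lemma nabla_xi x u : U x ->
  'D_u (xi CM a) x + Gam x u (xi CM a x) = - (u *m ph x).
Proof.
move=> Ux; set W := _ + _.
have Wph : W *m ph x = u - eta_at x u *: xi CM a x.
  have := nabla_phi u (xi CM a x) Ux.
  have -> : xi CM a x *m 'D_u ph x = - ('D_u (xi CM a) x *m ph x).
    apply/eqP; rewrite -addr_eq0 addrC; apply/eqP.
    have [_ <-] := is_derive_mulmx (is_derive_xi u Ux) (is_derive_phi u Ux).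
    exact: (derive_near_cst U_open u Ux phi_xi).
  rewrite phi_xi// [Gam x u 0]christoffel_formE mul0mx addr0 -opprD -mulmxDl -/W.
  rewrite (inner_sym u _ (G_sym Ux)) inner_xi// eta_xi// scale1r => /eqP.
  by rewrite eqr_oppLR opprB => /eqP.
have Wxi : eta_at x W = 0.
  rewrite -inner_xi// inner_sym; last exact: G_sym.
  have Mid : is_derive x u id (u : vec) by exact: is_derive_id.
  have [_] := is_derive_metric U_open G_smooth G_sym G_pos Ux Mid
    (is_derive_xi u Ux) (is_derive_xi u Ux).
  rewrite -/W (derive_near_cst (w := (1 : R)) U_open u Ux); last first.
    by move=> y Uy; rewrite inner_xi// eta_xi.
  by rewrite (inner_sym _ W (G_sym Ux)); lra.
have := phi_phi CM W Ux; rewrite Wph Wxi scale0r addr0 mulmxBl -scalemxAl phi_xi//.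
by rewrite scaler0 subr0 => ->; rewrite opprK.
Qed.

(** By the Ricci identity and nabla xi = -phi, the left side is (nabla_v phi)u - (nabla_u phi)v. *)
Lemma curvature_xi x u v : U x ->
  curvature_at G x u v (xi CM a x) = eta_at x v *: u - eta_at x u *: v.
Proof.
move=> Ux.
have dP w w' : is_derive x w (fun y => - (w' *m ph y)) (- (w' *m 'D_w ph x)).
  apply: is_deriveN.
  apply: is_derive_eq (is_derive_mulmx (@is_derive_cst _ _ _ w' x w) (is_derive_phi w Ux)) _.
  by rewrite mul0mx add0r.
have sxi := @xi_smooth _ _ _ CM a.
have dvu := is_derive_smooth u (smooth_on_derive v sxi) Ux.
have duv := is_derive_smooth v (smooth_on_derive u sxi) Ux.
rewrite (Schwarz U_open _ _ sxi Ux) in duv.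
rewrite (ricci_identity U_open G_smooth G_pos Ux (fun y => @is_derive_xi y u)
  (fun y => @is_derive_xi y v) dvu duv (fun y => @nabla_xi y v) (fun y => @nabla_xi y u)
  (dP u v) (dP v u)).
have GN b w : Gam x b (- w) = - Gam x b w by rewrite !christoffel_formE mulNmx.
apply: (inner_nondeg (fun b => @G_pos x b Ux)) => z.
have := congr1 (fun t => inner (G x) t z) (nabla_phi u v Ux).
have := congr1 (fun t => inner (G x) t z) (nabla_phi v u Ux).
rewrite (christoffel_form_sym U_open G_smooth G_sym v u Ux) (inner_sym u v (G_sym Ux)).
rewrite !GN !inner_addl.
generalize_inner.
lra.
Qed.

(** The Ricci identity for the field phi w with w constant. *)
Lemma curvature_phi x u v w z : U x ->
  inner (G x) (curvature_at G x u v (w *m ph x)) z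
  = inner (G x) (curvature_at G x u v w *m ph x) z
    - inner (G x) v w * inner (G x) (u *m ph x) z
    + inner (G x) (u *m ph x) w * inner (G x) v z
    + inner (G x) u w * inner (G x) (v *m ph x) z
    - inner (G x) (v *m ph x) w * inner (G x) u z.
Proof.
move=> Ux.
have sph := @phi_smooth _ _ _ CM a.
have C b w' : is_derive x b (fun=> w' : vec) (0 : vec) by exact: is_derive_cst.
(* nabla_b (phi w) by the Sasakian condition, with no derivative of phi left. Writing eta(w) as
   g(xi, w) lets metric compatibility differentiate it. *)
pose P b y := inner (G y) b w *: xi CM a y - inner (G y) (xi CM a y) w *: b + Gam y b w *m ph y.
have dZ b y : U y -> is_derive y b (fun y' => w *m ph y') (w *m 'D_b ph y).
  move=> Uy; apply: is_derive_eq (is_derive_mulmx (@is_derive_cst _ _ _ w y b) (is_derive_phi b Uy)) _.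
  by rewrite mul0mx add0r.
have dZ2 b b' : is_derive x b (fun y => w *m 'D_b' ph y) (w *m 'D_b ('D_b' ph) x).
  apply: is_derive_eq (is_derive_mulmx (C b w)
    (is_derive_smooth b (smooth_on_derive b' sph) Ux)) _.
  by rewrite mul0mx add0r.
have EP b y : U y -> w *m 'D_b ph y + Gam y b (w *m ph y) = P b y.
  move=> Uy; have /eqP := nabla_phi b w Uy.
  by rewrite subr_eq /P inner_xi// => /eqP.
pose DG b b' : vec := 'D_b (fun y => Gam y b' w) x.
pose dP b b' : vec := (inner (G x) (Gam x b b') w + inner (G x) b' (Gam x b w)) *: xi CM a x
  + inner (G x) b' w *: 'D_b (xi CM a) x
  - (- inner (G x) (b *m ph x) w + inner (G x) (xi CM a x) (Gam x b w)) *: b'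
  + (DG b b' *m ph x + Gam x b' w *m 'D_b ph x).
have dPE b b' : is_derive x b (P b') (dP b b').
  have Mid : is_derive x b id (b : vec) by exact: is_derive_id.
  have H := is_derive_metric U_open G_smooth G_sym G_pos Ux Mid.
  have dxi := is_derive_xi b Ux.
  apply: is_derive_eq (is_deriveD (is_deriveB (is_derive_scalemx (H _ _ _ _ (C b b') (C b w)) dxi)
    (is_derive_scalemx (H _ _ _ _ dxi (C b w)) (C b b')))
    (is_derive_mulmx (is_derive_christoffel_form_cst U_open G_smooth G_pos b b' w Ux)
       (is_derive_phi b Ux))) _.
  by rewrite /dP !add0r (nabla_xi b Ux) innerNl scaler0 addr0.
have duv := dZ2 u v; rewrite (Schwarz U_open _ _ sph Ux) in duv.
rewrite (ricci_identity U_open G_smooth G_pos Ux (dZ u) (dZ v) duv (dZ2 v u)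
  (EP v) (EP u) (dPE u v) (dPE v u)).
(* Only the second, third and fourth terms on the right fail to be symmetric in b and b'; the others
   cancel in the difference. *)
have E b b' : inner (G x) (dP b b' + Gam x b (P b' x)) z =
  (inner (G x) (Gam x b b') w + inner (G x) b' (Gam x b w) + inner (G x) b (Gam x b' w))
    * inner (G x) (xi CM a x) z
  + inner (G x) ((DG b b' + Gam x b (Gam x b' w)) *m ph x) z
  - inner (G x) b' w * inner (G x) (b *m ph x) z
  + inner (G x) (b *m ph x) w * inner (G x) b' z
  - inner (G x) (xi CM a x) (Gam x b w) * inner (G x) b' z
  - inner (G x) (xi CM a x) (Gam x b' w) * inner (G x) b z
  - inner (G x) (xi CM a x) w * inner (G x) (Gam x b b') z.
  have GD : Gam x b (P b' x) = inner (G x) b' w *: Gam x b (xi CM a x)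
      - inner (G x) (xi CM a x) w *: Gam x b b' + Gam x b (Gam x b' w *m ph x).
    by rewrite /P -addrA christoffel_form_linr -scaleNr christoffel_form_linr scaleNr addrA.
  have := congr1 (fun t => inner (G x) (inner (G x) b' w *: t) z) (nabla_xi b Ux).
  have := congr1 (fun t => inner (G x) t z) (nabla_phi b (Gam x b' w) Ux).
  rewrite GD /dP -!inner_xi// !inner_addl.
  by generalize_inner; lra.
have lin t t' : inner (G x) (t - t') z = inner (G x) t z - inner (G x) t' z.
  by rewrite innerDl innerNl.
rewrite lin !E curvature_atE (christoffel_form_sym U_open G_smooth G_sym v u Ux).
rewrite -!/(DG _ _) !inner_addl.

by generalize_inner; lra.
Qed.

Variable c : R.
Hypothesis CM_space_form : constant_phi_sectional_curvature CM c.

(** The algebraic formula in the tangent space at x, tested against every w. The coefficient (c + 3)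
    / 4 is k + 1, and the orthogonality of u to phi v removes the term with factor 3. *)
Lemma sasakian_space_form_curvature_at x u v : U x -> inner (G x) u u = 1 ->
  inner (G x) u v = 0 -> inner (G x) u (v *m ph x) = 0 ->
  curvature_at G x u v u = - ((c + 3) / 4) *: v
    + (c - 1) / 4 *: (eta_at x u ^+ 2 *: v - (eta_at x u * eta_at x v) *: u
                      + eta_at x v *: xi CM a x).
Proof.
move=> Ux uu uv uphv.
pose Rm b b' w z := inner (G x) (curvature_at G x b b' w) z.
have Rm_alt b b' w z : Rm b b' w z = - Rm b' b w z.
  by rewrite /Rm curvature_atNl innerNl.
have Rm_skew b b' w z : Rm b b' w z = - Rm b b' z w.
  exact: (curvature_at_skew U_open G_smooth G_sym G_pos).
have Rm_bianchi b b' w z : Rm b b' w z + Rm b' w b z + Rm w b b' z = 0.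
  by rewrite /Rm -!innerDl (curvature_at_bianchi U_open G_smooth G_sym)// inner0l.
have Rm_pair := curvature_pair_sym Rm_alt Rm_skew Rm_bianchi.
have Rm_lin k b b' w z t : Rm (k *: b + b') w z t = k * Rm b w z t + Rm b' w z t.
  rewrite !(Rm_pair _ w) /Rm (curvature_at_linr U_open G_smooth G_pos)//.
  by rewrite inner_linl.
have Rm_xi b b' w : Rm b b' (xi CM a x) w
    = eta_at x b' * inner (G x) b w - eta_at x b * inner (G x) b' w.
  by rewrite /Rm curvature_xi// innerDl innerNl !innerZl.
have Rm_J b b' w z : Rm b b' (w *m ph x) z + Rm b b' w (z *m ph x)
  = - inner (G x) b' w * inner (G x) (b *m ph x) z
    + inner (G x) (b *m ph x) w * inner (G x) b' z
    + inner (G x) b w * inner (G x) (b' *m ph x) z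
    - inner (G x) (b' *m ph x) w * inner (G x) b z.
  by rewrite /Rm curvature_phi// (inner_phi Ux (curvature_at _ _ _ _ _)); ring.
have Rm_hol b : inner (G x) b b = 1 -> eta_at x b = 0 ->
    Rm b (b *m ph x) (b *m ph x) b = c.
  move=> bb eb; rewrite -(CM_space_form Ux bb eb) /sectional_curvature.
  rewrite metric_phi// bb eb mulr0 subr0 mul1r.
  have -> : inner (G x) b (b *m ph x) = 0.
    have := inner_phi Ux b b; rewrite (inner_sym _ b (G_sym Ux)); lra.
  by rewrite expr0n subr0 divr1.
apply: (inner_nondeg (fun b => @G_pos x b Ux)) => w.
rewrite -[LHS]/(Rm u v u w).
rewrite (@sasakian_space_form_curvature R _ (inner (G x)) (fun b => b *m ph x)
  (fun b => eta_at x b) (xi CM a x) (inner_linl (G x)) (fun b b' => inner_sym b b' (G_sym Ux))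
  (fun b => @G_pos x b Ux) (ph_lin x) (eta_lin x) (fun b => phi_phi CM b Ux) (eta_xi CM Ux)
  (fun b b' => metric_phi CM b b' Ux) Rm Rm_lin Rm_alt Rm_skew Rm_bianchi Rm_xi Rm_J c Rm_hol).
rewrite !inner_addl uu uv uphv inner_xi//.
by generalize_inner; field.
Qed.

End SasakianChart.

(** * Curves *)

Section CovariantDerivative.
Variables (R : realType) (n : nat) (N : manifold R n.*2.+1) (CM : contact_metric N).
Hypothesis CM_sasakian : sasakian CM.
Variables (I : set R) (gam : R -> N).
Hypothesis I_open : open I.
Hypothesis gam_smooth : smooth_curve I gam.
Variable a : chart N.
Notation vec := 'rV[R]_n.*2.+1.
Notation D := (curve_dom I gam a).
Notation G := (metric CM a).
Notation Gam := (christoffel_form G).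
Notation loc := (local_curve gam a).
Notation T := (velocity gam a).
Notation eta_at t u := ((u *m eta CM a (loc t)) 0 0).
Implicit Types (t : R) (X Y : R -> vec).

Let G_smooth := @gram_smooth _ _ _ (metric CM) a.
Let G_sym := @gram_sym _ _ _ (metric CM) a.
Let G_pos := @gram_pos _ _ _ (metric CM) a.
Let U_open := @codom_open _ _ N a.

Lemma local_curve_codom t : D t -> Defs.codom a (loc t).
Proof. by move=> [_ at_]; exists (gam t). Qed.

Lemma curve_dom_open : open D.
Proof.
rewrite openE => t [It at_]; apply: filterI; first exact: open_nbhs_nbhs.
by apply: gam_smooth.1 => //; apply: open_nbhs_nbhs; split => //; exact: dom_open.
Qed.

Lemma is_derive_local_curve t : D t -> is_derive t 1 loc (T t).
Proof.
by move=> Dt; rewrite /velocity derive1E; exact: is_derive_smooth (gam_smooth.2 a) Dt.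
Qed.

(* Solving for the ordinary derivative makes the definition also assert differentiability. *)
Definition has_covariant_derivative t X DX :=
  is_derive t 1 X (DX - Gam (loc t) (T t) (X t)).
Notation has_cov := has_covariant_derivative.

Lemma has_covE t (E : along N) DX : has_cov t (E a) DX ->
  covariant_derivative gam (metric CM) E a t = DX.
Proof. by move=> [_ H]; rewrite /covariant_derivative derive1E H subrK. Qed.

Lemma has_cov_vector_field t (E : along N) : vector_field_along I gam E -> D t ->
  has_cov t (E a) (covariant_derivative gam (metric CM) E a t).
Proof.
move=> [sE _] Dt; rewrite /has_cov /covariant_derivative derive1E addrK.
exact: is_derive_smooth (sE a) Dt.
Qed.

Lemma has_cov_near t X Y DX : D t -> (forall s, D s -> X s = Y s) ->
  has_cov t X DX -> has_cov t Y DX.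
Proof.
move=> Dt XY; rewrite /has_cov (XY t Dt).
by apply: near_eq_is_derive; exact: (near_open curve_dom_open Dt XY).
Qed.

Lemma has_cov_add t X Y DX DY : has_cov t X DX -> has_cov t Y DY ->
  has_cov t (fun s => X s + Y s) (DX + DY).
Proof.
move=> dX dY; apply: is_derive_eq (is_deriveD dX dY) _.
by rewrite !christoffel_formE mulmxDl opprD addrACA.
Qed.

Lemma has_cov_scale t (f : R -> R) X (df : R) DX : is_derive t 1 f df -> has_cov t X DX ->
  has_cov t (fun s => f s *: X s) (df *: X t + f t *: DX).
Proof.
move=> dft dX; apply: is_derive_eq (is_derive_scalemx dft dX) _.
by rewrite !christoffel_formE scalerBr addrA scalemxAl.
Qed.

Lemma has_cov0 t : has_cov t (fun=> 0) 0.
Proof.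
by rewrite /has_cov christoffel_formE mul0mx subr0; exact: is_derive_cst.
Qed.

Lemma is_derive_inner_along t X Y DX DY : D t -> has_cov t X DX -> has_cov t Y DY ->
  is_derive t 1 (fun s => inner (G (loc s)) (X s) (Y s))
    (inner (G (loc t)) DX (Y t) + inner (G (loc t)) (X t) DY).
Proof.
move=> Dt dX dY.
have := is_derive_metric U_open G_smooth G_sym G_pos (local_curve_codom Dt)
  (is_derive_local_curve Dt) dX dY.
by rewrite !subrK.
Qed.

Lemma has_cov_xi t : D t -> has_cov t (fun s => xi CM a (loc s)) (- (T t *m phi CM a (loc t))).
Proof.
move=> Dt; have Ut := local_curve_codom Dt.
rewrite /has_cov -(nabla_xi CM_sasakian _ Ut) addrK.
by apply: is_derive_chain (is_derive_local_curve Dt); exact: (@xi_smooth _ _ _ CM a [::]).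
Qed.

Lemma has_cov_phi t X DX : D t -> has_cov t X DX ->
  has_cov t (fun s => X s *m phi CM a (loc s))
    (DX *m phi CM a (loc t) + (inner (G (loc t)) (T t) (X t) *: xi CM a (loc t)
                               - eta_at t (X t) *: T t)).
Proof.
move=> Dt dX; have Ut := local_curve_codom Dt.
have dphi := is_derive_chain (@phi_smooth _ _ _ CM a [::] _ Ut) (is_derive_local_curve Dt).
apply: is_derive_eq (is_derive_mulmx dX dphi) _.
rewrite -(nabla_phi CM_sasakian _ _ Ut) mulmxBl -!addrA; congr (_ + _).
by rewrite addrC; congr (_ + _); rewrite addrCA subrr addr0.
Qed.
End CovariantDerivative.

Lemma is_derive_eq_on (R : realType) (D : set R) (h1 h2 : R -> R) (d1 d2 t : R) :
  open D -> D t -> (forall s, D s -> h1 s = h2 s) ->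
  is_derive t 1 h1 d1 -> is_derive t 1 h2 d2 -> d1 = d2.
Proof.
by move=> oD Dt h12 [_ <-] [_ <-]; apply: near_eq_derive; exact: (near_open oD Dt h12).
Qed.

Lemma is_derive_cst_on (R : realType) (D : set R) (h : R -> R) (w d t : R) :
  open D -> D t -> (forall s, D s -> h s = w) -> is_derive t 1 h d -> d = 0.
Proof. by move=> oD Dt hw [_ <-]; exact: (derive_near_cst oD 1 Dt hw). Qed.

(** * Frenet curves whose acceleration is orthogonal to phi T *)

Section FrenetCurve.
Variables (R : realType) (n : nat) (N : manifold R n.*2.+1) (CM : contact_metric N).
Variables (c : R) (I : set R) (gam : R -> N).
Variables (r : nat) (E : nat -> along N) (kappa : nat -> R -> R).
Hypothesis CM_space_form : sasakian_space_form CM c.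
Hypothesis I_open : open I.
Hypothesis r_ge2 : (1 < r)%N.
Hypothesis gam_frenet : frenet_curve I gam (metric CM) r E kappa.
Hypothesis tension_orth : tension_orth_phi_velocity CM I gam.
Variable a : chart N.
Notation vec := 'rV[R]_n.*2.+1.
Notation D := (curve_dom I gam a).
Notation G := (metric CM a).
Notation loc := (local_curve gam a).
Notation T := (velocity gam a).
Notation eta_at t u := ((u *m eta CM a (loc t)) 0 0).
Notation ip t u v := (inner (G (loc t)) u v).
Notation has_cov := (has_covariant_derivative CM gam a).
Implicit Types (t : R) (u v : vec).

Let k := (c - 1) / 4.
Let gam_smooth : smooth_curve I gam. Proof. by case: gam_frenet => -[]. Qed.
Let CM_sasakian : sasakian CM := CM_space_form.1.
Let D_open : open D := curve_dom_open I_open gam_smooth (a := a).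
Let codomP t (Dt : D t) : Defs.codom a (loc t) := local_curve_codom Dt.

Notation E2 := (E 2%N a).
Notation k1 := (kappa 1%N).

(* The component of the covariant derivative of E_2 orthogonal to T; it vanishes when r = 2. *)
Definition frenet_normal t : vec := if (2 < r)%N then kappa 2%N t *: E 3%N a t else 0.

Definition frenet_normal_cov t : vec :=
  if (2 < r)%N then
    'D_1 (kappa 2%N) t *: E 3%N a t
    + kappa 2%N t *: (- (kappa 2%N t *: E2 t)
                      + (if (3 < r)%N then kappa 3%N t *: E 4%N a t else 0))
  else 0.

Notation V := frenet_normal.
Notation W := frenet_normal_cov.

Let orthonormal t i j : D t -> (1 <= i <= r)%N -> (1 <= j <= r)%N ->
  ip t (E i a t) (E j a t) = (i == j)%:R.
Proof. by move=> Dt; case: gam_frenet => _ _ _ /(_ a t Dt)[_ + _]; apply. Qed.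

Let E1E t : D t -> E 1%N a t = T t.
Proof. by move=> Dt; case: gam_frenet => _ _ _ /(_ a t Dt)[]. Qed.

Let ipC t u v : D t -> ip t u v = ip t v u.
Proof. by move=> /codomP Ut; apply: inner_sym; exact: gram_sym Ut. Qed.

Let cov_frenet t i : D t -> (1 <= i <= r)%N ->
  has_cov t (E i a) ((if (1 < i)%N then - (kappa i.-1 t *: E i.-1 a t) else 0)
                     + (if (i < r)%N then kappa i t *: E i.+1 a t else 0)).
Proof.
move=> Dt ir; case: gam_frenet => _ /(_ i ir) vE _ /(_ a t Dt)[_ _ /(_ i ir) <-].
exact: has_cov_vector_field vE Dt.
Qed.

Let kappa_derive i t : (1 <= i < r)%N -> I t -> is_derive t 1 (kappa i) ('D_1 (kappa i) t).
Proof.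
by move=> ir It; case: gam_frenet => _ _ /(_ i ir)[sk _] _; exact: is_derive_smooth sk It.
Qed.

Let kappa_derive2 i t : (1 <= i < r)%N -> I t ->
  is_derive t 1 ('D_1 (kappa i)) ('D_1 ('D_1 (kappa i)) t).
Proof.
move=> ir It; case: gam_frenet => _ _ /(_ i ir)[sk _] _.
exact: is_derive_smooth (smooth_on_derive (1 : R) sk) It.
Qed.

Let k1_gt0 t : I t -> 0 < k1 t.
Proof. by case: gam_frenet => _ _ /(_ 1%N r_ge2)[_ ?] _; auto. Qed.

Let cov_T t : D t -> has_cov t T (k1 t *: E2 t).
Proof.
move=> Dt; apply: (has_cov_near I_open gam_smooth Dt E1E).
by have := @cov_frenet t 1 Dt (ltnW r_ge2); rewrite /= r_ge2 add0r.
Qed.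

Let cov_E2 t : D t -> has_cov t E2 (- (k1 t *: T t) + V t).
Proof. by move=> Dt; have := @cov_frenet t 2 Dt r_ge2; rewrite /= E1E. Qed.

Let cov_V t : D t -> has_cov t V (W t).
Proof.
move=> Dt; rewrite /frenet_normal /frenet_normal_cov; case: ifP => r2; last exact: has_cov0.
apply: has_cov_scale; first exact: (@kappa_derive 2%N t r2 Dt.1).
exact: (@cov_frenet t 3).
Qed.

Let r_ge1 : (0 < 1 <= r)%N := ltnW r_ge2.

Let TT t : D t -> ip t (T t) (T t) = 1.
Proof. by move=> Dt; rewrite -E1E// (orthonormal Dt r_ge1 r_ge1). Qed.

Let TE t : D t -> ip t (T t) (E2 t) = 0.
Proof. by move=> Dt; rewrite -E1E// (@orthonormal t 1%N 2%N Dt r_ge1 r_ge2). Qed.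

Let EE t : D t -> ip t (E2 t) (E2 t) = 1.
Proof. by move=> Dt; rewrite (@orthonormal t 2%N 2%N Dt r_ge2 r_ge2). Qed.

Let VT t : D t -> ip t (V t) (T t) = 0.
Proof.
move=> Dt; rewrite /frenet_normal; case: ifP => r2; last by rewrite inner0l.
by rewrite innerZl -E1E// (@orthonormal t 3%N 1%N Dt r2 r_ge1) mulr0.
Qed.

Let VE t : D t -> ip t (V t) (E2 t) = 0.
Proof.
move=> Dt; rewrite /frenet_normal; case: ifP => r2; last by rewrite inner0l.
by rewrite innerZl (@orthonormal t 3%N 2%N Dt r2 r_ge2) mulr0.
Qed.

Lemma tension_frenet t : D t -> tension gam (metric CM) a t = k1 t *: E2 t.
Proof. by move=> Dt; exact: has_covE (cov_T Dt). Qed.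

Let E2_phi t : D t -> ip t (E2 t) (T t *m phi CM a (loc t)) = 0.
Proof.
move=> Dt; have := tension_orth Dt; rewrite tension_frenet// innerZl => /eqP.
by rewrite mulf_eq0 gt_eqF ?k1_gt0//=; [move/eqP|exact: Dt.1].
Qed.

Let k1' t := 'D_1 k1 t.

Let cov_tension t : D t -> has_cov t (tension gam (metric CM) a)
  (k1' t *: E2 t + k1 t *: (- (k1 t *: T t) + V t)).
Proof.
move=> Dt; apply: (has_cov_near (X := fun s => k1 s *: E2 s) I_open gam_smooth Dt).
  by move=> s Ds; rewrite tension_frenet.
by apply: has_cov_scale (cov_E2 Dt); exact: (@kappa_derive 1%N t r_ge2 Dt.1).
Qed.

(** The terms before the subtraction differentiate kappa_1' E_2 + kappa_1 (-kappa_1 T + V). The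
    subtracted one is the curvature of a space form, whose formula applies because E_2 is orthogonal
    to T and to phi T. *)
Lemma bitension_frenet t : D t -> bitension gam (metric CM) a t =
  ('D_1 k1' t *: E2 t + k1' t *: (- (k1 t *: T t) + V t))
  + (k1' t *: (- (k1 t *: T t) + V t)
     + k1 t *: (- (k1' t *: T t + k1 t *: (k1 t *: E2 t)) + W t))
  - k1 t *: (- ((c + 3) / 4) *: E2 t
      + k *: (eta_at t (T t) ^+ 2 *: E2 t - (eta_at t (T t) * eta_at t (E2 t)) *: T t
              + eta_at t (E2 t) *: xi CM a (loc t))).
Proof.
move=> Dt; rewrite /bitension; congr (_ - _).
  apply: has_covE.
  apply: (has_cov_near (X := fun s => k1' s *: E2 s + k1 s *: (- (k1 s *: T s) + V s))
    I_open gam_smooth Dt).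
    by move=> s Ds; exact/esym/has_covE/cov_tension.
  apply: has_cov_add.
    by apply: has_cov_scale (cov_E2 Dt); exact: (@kappa_derive2 1%N t r_ge2 Dt.1).
  apply: has_cov_scale; first exact: (@kappa_derive 1%N t r_ge2 Dt.1).
  apply: has_cov_add (cov_V Dt).
  have dk := @kappa_derive 1%N t r_ge2 Dt.1.
  have := has_cov_scale (is_deriveN dk) (cov_T Dt).
  rewrite (_ : (fun s => _) = (fun s => - (k1 s *: T s))); last first.
    by apply/funext => s; rewrite scaleNr.
  by rewrite !scaleNr opprD.
rewrite tension_frenet// (sasakian_space_form_curvature_at CM_sasakian CM_space_form.2)//.
- have -> : eta_at t (k1 t *: E2 t) = k1 t * eta_at t (E2 t) by rewrite -scalemxAl mxE.
  rewrite !(scalerDr, scalerN, scalerA).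
  by congr (_ *: _ + (_ *: _ - _ *: _ + _ *: _)); rewrite ?mulrN ?mulNr /k; ring.
- exact: codomP.
- exact: TT.
- by rewrite ipC// innerZl ipC// TE// mulr0.
- rewrite ipC// -scalemxAl innerZl ipC// -[X in _ * X]opprK -(inner_phi CM (codomP Dt)).
  by rewrite ipC// E2_phi// oppr0 mulr0.
Qed.

Notation f t := (eta_at t (T t)).
Notation al t := (eta_at t (E2 t)).
Notation be t := (eta_at t (V t)).

(** eta(X) = g(xi, X), and nabla_T xi = -phi T accounts for the second term. *)
Let is_derive_eta t (X : R -> vec) DX : D t -> has_cov t X DX ->
  is_derive t 1 (fun s => eta_at s (X s)) (eta_at t DX - ip t (T t *m phi CM a (loc t)) (X t)).
Proof.
move=> Dt dX; have Ut := codomP Dt.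
have H := is_derive_inner_along gam_smooth Dt
  (has_cov_xi CM_sasakian gam_smooth Dt) dX.
rewrite innerNl inner_xi// addrC in H.
apply: near_eq_is_derive H; apply: (near_open D_open Dt) => s Ds.
by rewrite inner_xi//; exact: codomP.
Qed.

Let T_phi t : D t -> ip t (T t *m phi CM a (loc t)) (T t) = 0.
Proof.
by move=> Dt; have := inner_phi CM (codomP Dt) (T t) (T t); rewrite [X in - X]ipC//; lra.
Qed.

Lemma is_derive_eta_velocity t : D t -> is_derive t 1 (fun s => f s) (k1 t * al t).
Proof.
move=> Dt; apply: is_derive_eq (is_derive_eta Dt (cov_T Dt)) _.
by rewrite T_phi// subr0 -scalemxAl mxE.
Qed.

Let etaD t u v : eta_at t (u + v) = eta_at t u + eta_at t v.
Proof. by rewrite mulmxDl mxE. Qed.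

Let etaZ t x u : eta_at t (x *: u) = x * eta_at t u.
Proof. by rewrite -scalemxAl mxE. Qed.

Let etaN t u : eta_at t (- u) = - eta_at t u.
Proof. by rewrite mulNmx mxE. Qed.

Let is_derive_eta_E2 t : D t -> is_derive t 1 (fun s => al s) (- k1 t * f t + be t).
Proof.
move=> Dt; apply: is_derive_eq (is_derive_eta Dt (cov_E2 Dt)) _.
by rewrite ipC// E2_phi// subr0 etaD etaN etaZ mulNr.
Qed.

(** Here nabla_T (phi T) = kappa_1 phi E_2 + xi - eta(T) T, whose product with E_2 is eta(E_2). *)
Let V_phi t : D t -> ip t (V t) (T t *m phi CM a (loc t)) = - al t.
Proof.
move=> Dt; have Ut := codomP Dt.
have := is_derive_inner_along gam_smooth Dt (cov_E2 Dt)
  (has_cov_phi CM_sasakian gam_smooth Dt (cov_T Dt)).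
move/(is_derive_cst_on D_open Dt E2_phi).
rewrite (ipC (E2 t) _ Dt) -scalemxAl !inner_addl TT// (ipC (T t) (_ *m _) Dt).
rewrite T_phi// inner_xi// TE//.
have -> : ip t (E2 t *m phi CM a (loc t)) (E2 t) = 0.
  by have := inner_phi CM Ut (E2 t) (E2 t); rewrite [X in - X]ipC//; lra.
by generalize_inner; lra.
Qed.

Let is_derive_eta_V t : D t -> is_derive t 1 (fun s => be s) (eta_at t (W t) + al t).
Proof.
move=> Dt; apply: is_derive_eq (is_derive_eta Dt (cov_V Dt)) _.
by rewrite ipC// V_phi// opprK.
Qed.

Let W_T t : D t -> ip t (W t) (T t) = 0.
Proof.
move=> Dt; have := is_derive_inner_along gam_smooth Dt (cov_V Dt) (cov_T Dt).
move/(is_derive_cst_on D_open Dt VT).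
by rewrite (ipC (V t) _ Dt) innerZl (ipC (E2 t) _ Dt) VE// mulr0 addr0.
Qed.

Let W_E2 t : D t -> ip t (W t) (E2 t) = - ip t (V t) (V t).
Proof.
move=> Dt; have := is_derive_inner_along gam_smooth Dt (cov_V Dt) (cov_E2 Dt).
move/(is_derive_cst_on D_open Dt VE).
rewrite (ipC (V t) _ Dt) !inner_addl (ipC (T t) _ Dt) VT//.
by generalize_inner; lra.
Qed.

(** * Consequences of the biharmonic equation in one chart *)

Section Biharmonic.
Hypothesis bitension0 : forall t, D t -> bitension gam (metric CM) a t = 0.
Hypothesis c_neq1 : c != 1.

Let bitension_inner t z : D t ->
  ip t (bitension gam (metric CM) a t) z = 0.
Proof. by move=> Dt; rewrite bitension0// inner0l. Qed.

Let ip_xi t u : D t -> ip t (xi CM a (loc t)) u = eta_at t u.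
Proof. by move=> /codomP Ut; rewrite inner_xi. Qed.

(** Along T the two curvature terms in eta(T) eta(E_2) cancel, which leaves -3 kappa_1 kappa_1' =
    0. *)
Lemma biharmonic_kappa1 t : D t -> 'D_1 k1 t = 0.
Proof.
move=> Dt; have := bitension_inner (T t) Dt; rewrite bitension_frenet// !inner_addl.
rewrite W_T// VT// TT// (ipC (E2 t) _ Dt) TE// ip_xi// -/(k1' t).
have := k1_gt0 Dt.1; move: (f t) (al t) (k1 t) (k1' t) ('D_1 k1' t) => f0 a0 x x' x'' x0 E0.
have /eqP : x' * x = 0 by lra.
by rewrite mulf_eq0 (gt_eqF x0) orbF => /eqP.
Qed.

(** With kappa_1 locally constant, the biharmonic equation divided by kappa_1 is solved for W. *)
Let W_inner t z : D t -> ip t (W t) z = (k1 t ^+ 2 - (k + 1)) * ip t (E2 t) z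
  + k * (f t ^+ 2 * ip t (E2 t) z - f t * al t * ip t (T t) z + al t * ip t (xi CM a (loc t)) z).
Proof.
move=> Dt; have := bitension_inner z Dt; rewrite bitension_frenet// !inner_addl.
rewrite (derive_near_cst (w := 0 : R) D_open 1 Dt biharmonic_kappa1) -/(k1' t).
have -> : k1' t = 0 by exact: biharmonic_kappa1.
have := k1_gt0 Dt.1; generalize_inner; rewrite /k.
move: (f t) (al t) (k1 t) => f0 a0 x x0 E0.
by apply: (mulfI (lt0r_neq0 x0)); lra.
Qed.

Let energy t : D t ->
  ip t (V t) (V t) = k + 1 - k1 t ^+ 2 - k * (f t ^+ 2 + al t ^+ 2).
Proof.
move=> Dt; have := W_inner (E2 t) Dt; rewrite W_E2// EE// TE// ip_xi//.
by move: (f t) (al t) (k1 t) => f0 a0 x; generalize_inner; lra.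
Qed.

Let W_V t : D t -> ip t (W t) (V t) = k * (al t * be t).
Proof.
move=> Dt; rewrite W_inner// !(ipC _ (V t) Dt) VE// VT// (ipC (V t) _ Dt) ip_xi//; ring.
Qed.

Let eta_W t : D t -> eta_at t (W t) = k1 t ^+ 2 * al t - al t.
Proof.
move=> Dt; rewrite -ip_xi// ipC// W_inner// !(ipC _ (xi CM a (loc t)) Dt) !ip_xi//.
by rewrite eta_xi//; [ring|exact: codomP].
Qed.

Let k_neq0 : k != 0.
Proof. by rewrite mulf_neq0 ?invr_eq0 ?subr_eq0// pnatr_eq0. Qed.

Let al_be t : D t -> al t * be t = 0.
Proof.
move=> Dt; have dk := @kappa_derive 1%N t r_ge2 Dt.1; rewrite biharmonic_kappa1// in dk.
have dV := is_derive_inner_along gam_smooth Dt (cov_V Dt) (cov_V Dt).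
have df := is_derive_eta_velocity Dt; have da := is_derive_eta_E2 Dt.
have dE := is_deriveB (is_deriveB (is_derive_cst (k + 1 : R) t 1) (is_derive_mul_fun dk dk))
  (is_deriveZ k (is_deriveD (is_derive_mul_fun df df) (is_derive_mul_fun da da))).
have := is_derive_eq_on D_open Dt energy dV dE.
rewrite [ip t (V t) (W t)]ipC// W_V//.
rewrite -[k *: _]/(k * _); move: (f t) (al t) (be t) (k1 t) => f0 a0 b0 x E0.
(* The two expressions for the derivative of |V|^2 are 2 k a b and -2 k a b: the terms kappa_1 f a
   from f' and a' cancel. *)
have /eqP : k * (a0 * b0) = 0 by lra.
by rewrite mulf_eq0 (negbTE k_neq0) => /eqP.
Qed.

(* Write f, a, b for eta at T, E_2, V.  Then (a b)' = a' b + kappa_1^2 a^2, while a b = 0. *)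
Lemma biharmonic_eta_E2 t : D t -> al t = 0.
Proof.
move=> Dt; apply/eqP; apply: contraT => al0.
have be0 : be t = 0.
  by have /eqP := al_be Dt; rewrite mulf_eq0 (negbTE al0) => /eqP.
have := is_derive_cst_on D_open Dt al_be
  (is_derive_mul_fun (is_derive_eta_E2 Dt) (is_derive_eta_V Dt)).
rewrite eta_W// be0 mulr0 add0r subrK => /eqP.
by rewrite !mulf_eq0 (negbTE al0) !(gt_eqF (k1_gt0 Dt.1)).
Qed.

Lemma biharmonic_normal_norm t : D t ->
  ip t (V t) (V t) = k + 1 - k1 t ^+ 2 - k * f t ^+ 2.
Proof. by move=> Dt; rewrite energy// biharmonic_eta_E2// expr0n addr0. Qed.

Lemma biharmonic_normal_cov t z : D t -> ip t (W t) z = - ip t (V t) (V t) * ip t (E2 t) z.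
Proof.
by move=> Dt; rewrite W_inner// biharmonic_normal_norm// biharmonic_eta_E2//; ring.
Qed.

(** |phi T|^2 = 1 - f^2, so only phi T = 0 must be excluded. There T = f xi, hence eta(V) = 0
    because V is orthogonal to T, and then 0 = eta(E_2)' = -kappa_1 f. *)
Lemma biharmonic_eta_velocity_lt1 t : D t -> f t != 0 -> f t ^+ 2 < 1.
Proof.
move=> Dt f0; have Ut := codomP Dt.
have := metric_phi CM (T t) (T t) Ut; rewrite TT// -expr2 => nphi.
have [Tphi|Tphi] := eqVneq (T t *m phi CM a (loc t)) 0; last first.
  by have := gram_pos (metric CM) Ut Tphi; rewrite nphi subr_gt0.
have TE1 : T t = f t *: xi CM a (loc t).
  have := phi_phi CM (T t) Ut; rewrite Tphi mul0mx => /esym/eqP.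
  by rewrite addrC subr_eq0 => /eqP.
have be0 : be t = 0.
  have := VT Dt; rewrite ipC// {1}TE1 innerZl ip_xi// => /eqP.
  by rewrite mulf_eq0 (negbTE f0) => /eqP.
have := is_derive_cst_on D_open Dt biharmonic_eta_E2 (is_derive_eta_E2 Dt).
rewrite be0 addr0 => /eqP.
by rewrite mulf_eq0 oppr_eq0 (gt_eqF (k1_gt0 Dt.1)) (negbTE f0).
Qed.
End Biharmonic.

(** Constancy of f gives eta(E_2) = 0 through f' = kappa_1 eta(E_2). The bitension is then a
    multiple of E_2, and the value assumed for W makes its coefficient vanish. *)
Lemma eta_velocity_cst_biharmonic w t : D t -> (forall s, D s -> f s = w) ->
  (forall s, D s -> 'D_1 k1 s = 0) ->
  W t = - (k + 1 - k1 t ^+ 2 - k * w ^+ 2) *: E2 t ->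
  bitension gam (metric CM) a t = 0.
Proof.
move=> Dt fw k1'0 WE.
have /eqP := is_derive_cst_on D_open Dt fw (is_derive_eta_velocity Dt).
rewrite mulf_eq0 (gt_eqF (k1_gt0 Dt.1)) => /eqP al0.
rewrite bitension_frenet// WE (derive_near_cst (w := 0 : R) D_open 1 Dt k1'0) /k1' k1'0// al0 fw//.
move: (E2 t) (T t) (V t) (xi CM a (loc t)) (k1 t) => e u v z x.
by apply/rowP => i; rewrite !mxE /k; field.
Qed.
End FrenetCurve.

(** * Passing from charts to the whole interval *)

Lemma is_derive0_cst_on_interval (R : realType) (I : set R) (h : R -> R) s t :
  is_interval I -> (forall t, I t -> is_derive t 1 h 0) -> I s -> I t -> h s = h t.
Proof.
move=> iI dh; wlog st : s t / s <= t => [H|] Is It.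
  by have [/H|/ltW/H ->] := leP s t; auto.
have dst u : u \in `[s, t] -> is_derive u 1 h 0.
  by rewrite in_itv/= => ust; apply: dh; exact: iI ust.
have [|x _] := @MVT_segment _ h (cst 0) s t st (fun u ust => dst u (subset_itv_oo_cc ust)).
  apply: continuous_in_subspaceT => u; rewrite inE => ust.
  by apply/differentiable_continuous/derivable1_diffP; have [] := dst u ust.
by rewrite /= mul0r => /eqP; rewrite subr_eq0 => /eqP.
Qed.

Section FrenetCurveCharts.
Variables (R : realType) (n : nat) (N : manifold R n.*2.+1) (CM : contact_metric N).
Variables (I : set R) (gam : R -> N).
Hypothesis I_open : open I.
Variables (r : nat) (E : nat -> along N) (kappa : nat -> R -> R).
Hypothesis gam_frenet : frenet_curve I gam (metric CM) r E kappa.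
Notation D := (curve_dom I gam).

Lemma frenet_geodesic_harmonic : r = 1%N -> Defs.harmonic I gam (metric CM).
Proof.
move=> r1 a t Dt; case: gam_frenet => -[gam_smooth _] vE _ fr.
apply: has_covE; apply: (has_cov_near (X := E 1%N a) I_open gam_smooth Dt).
  by move=> s /fr[].
have v1 : (0 < 1 <= r)%N by rewrite r1.
have := has_cov_vector_field CM (vE 1%N v1) Dt.
by case: (fr a t Dt) => _ _ /(_ 1%N v1) ->; rewrite r1 addr0.
Qed.

(** The velocity inherits its transformation law from [E 1], which is a vector field along the
    curve; eta transforms inversely. *)
Lemma eta_velocity_chart a b t : D a t -> D b t ->
  eta_velocity CM gam a t = eta_velocity CM gam b t.
Proof.
move=> Da Db; case: gam_frenet => -[gam_smooth r1] vE _ fr.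
have v1 : (0 < 1 <= r)%N by case/andP: r1 => ->.
have [_ tr] := vE 1%N v1.
rewrite /eta_velocity.
have [<- _ _] := fr a t Da; have [<- _ _] := fr b t Db.
have ov : overlap a b (local_curve gam a t).
  by exists (gam t) => //; split; [exact: Da.2|exact: Db.2].
rewrite (eta_transition CM ov) mulmxA -(tr a b t Da Db).
by rewrite /transition /= /local_curve coordK//; exact: Da.2.
Qed.
End FrenetCurveCharts.

(** * The two implications *)

Lemma proper_biharmonic_circle_or_helix (R : realType) (n : nat) (N : manifold R n.*2.+1)
    (CM : contact_metric N) (c : R) (I : set R) (gam : R -> N)
    (r : nat) (E : nat -> along N) (kappa : nat -> R -> R) :
  sasakian_space_form CM c -> c != 1 ->
  open I -> is_interval I -> I !=set0 ->
  frenet_curve I gam (metric CM) r E kappa ->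
  ~ legendre CM I gam ->
  tension_orth_phi_velocity CM I gam ->
  proper_biharmonic I gam (metric CM) ->
  exists w : R,
     [/\ w != 0, -1 < w < 1, (forall a t, curve_dom I gam a t -> eta_velocity CM gam a t = w) &
       (circle I gam (metric CM) E kappa /\
        forall t, I t -> kappa 1%N t ^+ 2 = (c + 3) / 4 - (c - 1) / 4 * w ^+ 2)
       \/
       (helix I gam (metric CM) E kappa /\
        forall t, I t -> kappa 1%N t ^+ 2 + kappa 2%N t ^+ 2
               = (c + 3) / 4 - (c - 1) / 4 * w ^+ 2)].
Proof.
move=> sf c1 oI iI [t0 It0] fr nleg orth [bih nharm].
have r2 : (1 < r)%N.
  case: (ltngtP r 1) => // [r0|r1]; last first.
    by case: nharm; exact: (frenet_geodesic_harmonic oI fr r1).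
  by case: fr => -[_ /andP[]]; case: r r0.
(* A chart around each point: derivatives are computed locally, but constancy is needed on all of
   the interval, which one chart may not cover. *)
have [ch chP] := choice (@chart_cover _ _ N).
have Dch t : I t -> curve_dom I gam (ch (gam t)) t by move=> It; split.
have bih' a t : curve_dom I gam a t -> bitension gam (metric CM) a t = 0 by exact: bih.
have k1cst s t : I s -> I t -> kappa 1%N s = kappa 1%N t.
  apply: is_derive0_cst_on_interval => // u Iu.
  case: (fr) => _ _ /(_ 1%N r2)[sk _] _.
  have dk := is_derive_smooth (1 : R) sk Iu.
  rewrite -[X in is_derive _ _ _ X]/(0 : R).
  suff <- : 'D_1 (kappa 1%N) u = 0 by [].
  exact: (biharmonic_kappa1 sf oI r2 fr orth (bih' _) (Dch u Iu)).
pose F t := eta_velocity CM gam (ch (gam t)) t.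
have FE a t : curve_dom I gam a t -> eta_velocity CM gam a t = F t.
  by move=> Dt; exact: (eta_velocity_chart fr Dt (Dch t Dt.1)).
have Fcst s t : I s -> I t -> F s = F t.
  apply: is_derive0_cst_on_interval => // u Iu; have Du := Dch u Iu.
  have gs : smooth_curve I gam by case: fr => -[].
  apply: (@near_eq_is_derive _ _ _ (eta_velocity CM gam (ch (gam u)))).
    exact: (near_open (curve_dom_open oI gs (a := ch (gam u))) Du (FE _)).
  have := is_derive_eta_velocity sf oI r2 fr Du.
  by rewrite (biharmonic_eta_E2 sf oI r2 fr orth (bih' _) c1 Du) mulr0.
have etaF a t : curve_dom I gam a t -> eta_velocity CM gam a t = F t0.
  by move=> Dt; rewrite (FE a t Dt); apply: Fcst => //; exact: Dt.1.
(* Not being Legendre only says that eta(T) is nonzero somewhere; constancy spreads this to every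
   point. *)
have F0 : F t0 != 0.
  by apply/eqP => F0; apply: nleg => a t Dt; rewrite etaF.
have F1 : F t0 ^+ 2 < 1.
  exact: (biharmonic_eta_velocity_lt1 sf oI r2 fr orth (bih' _) c1 (Dch t0 It0) F0).
have Flt1 : -1 < F t0 < 1.
  by rewrite -ltr_norml -(@expr_lt1 _ 2)// real_normK ?num_real.
exists (F t0); split => //.
have on t i j : I t -> (1 <= i <= r)%N -> (1 <= j <= r)%N ->
    inner_along gam (metric CM) (E i) (E j) (ch (gam t)) t = (i == j)%:R.
  by move=> /Dch Dt; case: (fr) => _ _ _ /(_ _ t Dt)[_ + _]; apply.
have kpos t i : I t -> (1 <= i < r)%N -> 0 < kappa i t.
  by move=> It ir; case: (fr) => _ _ /(_ i ir)[_ ?] _; auto.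
(* The squared length of V, equal to kappa_2^2 or, when r = 2, to 0: this is the curvature relation
   of both cases. *)
have nV t : I t -> (if (2 < r)%N then kappa 2%N t ^+ 2 else 0)
    = (c + 3) / 4 - (c - 1) / 4 * F t0 ^+ 2 - kappa 1%N t ^+ 2.
  move=> It; have := biharmonic_normal_norm sf oI r2 fr orth (bih' _) c1 (Dch t It).
  rewrite -/(eta_velocity CM gam (ch (gam t)) t) etaF; last exact: Dch.
  rewrite /frenet_normal; case: ifP => r3.
    rewrite innerZl inner_sym; last exact: gram_sym (local_curve_codom (Dch t It)).
    by rewrite innerZl -/(inner_along _ _ _ _ _ _) on// eqxx mulr1 => E0; lra.
  by rewrite inner0l => E0; lra.
have k1const : constant_on I (kappa 1%N).
  by exists (kappa 1%N t0) => t It; exact: k1cst.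
have [r3|r3|r3] := ltngtP r 2.
- by rewrite ltnNge r2 in r3.
(* If r were at least 4, W would have the component kappa_2 kappa_3 > 0 along E_4, whereas W is a
   multiple of E_2. *)
- have r4 : r = 3%N.
    apply/eqP; rewrite eqn_leq r3 andbT leqNgt; apply/negP => r4.
    have := biharmonic_normal_cov sf oI r2 fr orth (bih' _) c1 (E 4%N (ch (gam t0)) t0) (Dch t0 It0).
    rewrite /frenet_normal_cov r3 r4 !(innerDl, innerZl, innerNl) -!/(inner_along _ _ _ _ _ _).
    rewrite !on// ?(ltnW r3) ?(ltnW r4)//=.
    rewrite !mulr0 oppr0 !add0r mulr1 => /eqP.
    by rewrite mulf_eq0 !gt_eqF// kpos.
  right; split; last by move=> t It; have := nV t It; rewrite r3; lra.
  split; [by rewrite -r4|exact: k1const|exists (kappa 2%N t0) => t It].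
  (* The curvature relation only fixes kappa_2^2; nonnegativity then fixes kappa_2. *)
  have k2 s : I s -> 0 <= kappa 2%N s by move=> Is; apply: ltW; exact: kpos.
  apply: (@pexpIrn _ 2); rewrite ?nnegrE ?k2//.
  by have := nV t It; have := nV t0 It0; rewrite r3 (k1cst t t0 It It0) => -> ->.
- left; split; last by move=> t It; have := nV t It; rewrite r3 /=; lra.
  by split => //; rewrite -r3.
Qed.

(** Circles and helices together: W = -kappa_2^2 E_2 when r = 3 and W = 0 when r = 2, and in both
    cases the curvature relation identifies the coefficient of E_2 with the one that annihilates the
    bitension. *)
Lemma circle_or_helix_proper_biharmonic (R : realType) (n : nat) (N : manifold R n.*2.+1)
    (CM : contact_metric N) (c : R) (I : set R) (gam : R -> N)
    (r : nat) (E : nat -> along N) (kappa : nat -> R -> R) (w : R) :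
  sasakian_space_form CM c ->
  open I -> I !=set0 ->
  frenet_curve I gam (metric CM) r E kappa -> (r == 2%N) || (r == 3%N) ->
  constant_on I (kappa 1%N) -> ((2 < r)%N -> constant_on I (kappa 2%N)) ->
  tension_orth_phi_velocity CM I gam ->
  (forall a t, curve_dom I gam a t -> eta_velocity CM gam a t = w) ->
  (forall t, I t -> kappa 1%N t ^+ 2 + (if (2 < r)%N then kappa 2%N t ^+ 2 else 0)
               = (c + 3) / 4 - (c - 1) / 4 * w ^+ 2) ->
  proper_biharmonic I gam (metric CM).
Proof.
move=> sf oI [t0 It0] fr r23 [x1 k1] k2 orth etaw kE.
have r2 : (1 < r)%N by case/orP: r23 => /eqP ->.
have [ch chP] := choice (@chart_cover _ _ N).
have D0 : curve_dom I gam (ch (gam t0)) t0 by split.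
split=> [a t Dt|/(_ _ _ D0)/eqP]; last first.
  (* The tension kappa_1 E_2 is nonzero, as kappa_1 > 0 and E_2 has length 1. *)
  rewrite (tension_frenet oI r2 fr)// scaler_eq0.
  case: (fr) => _ _ /(_ 1%N r2)[_ /(_ t0 It0)/gt_eqF -> /=] /(_ _ _ D0)[_ /(_ 2%N 2%N r2 r2)].
  rewrite /inner_along => + _ => /[swap] /eqP ->.
  by rewrite inner0l => /esym/eqP; rewrite oner_eq0.
apply: (eta_velocity_cst_biharmonic sf oI r2 fr orth Dt (w := w)) => [s Ds|s Ds|].
- exact: etaw.
- exact: (derive_near_cst oI 1 Ds.1 k1).
rewrite /frenet_normal_cov; case: ifP => [r3|r3].
  have -> : (3 < r)%N = false by case/orP: r23 => /eqP ->.
  have [x2 k2'] := k2 r3.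
  rewrite (derive_near_cst oI 1 Dt.1 k2') scale0r add0r addr0 scalerN scalerA -scaleNr.
  congr (_ *: _); have := kE t Dt.1; rewrite r3; lra.
rewrite (_ : _ - _ = 0) ?oppr0 ?scale0r//.
by have := kE t Dt.1; rewrite r3; lra.
Qed.

Theorem theorem3p4 (R : realType) (n : nat) (N : manifold R n.*2.+1)
    (CM : contact_metric N) (c : R) (I : set R) (gam : R -> N)
    (r : nat) (E : nat -> along N) (kappa : nat -> R -> R) :
  (2 <= n)%N ->
  sasakian_space_form CM c ->
  c != 1 ->
  open I -> is_interval I -> I !=set0 ->
  frenet_curve I gam (metric CM) r E kappa ->
  ~ legendre CM I gam ->
  tension_orth_phi_velocity CM I gam ->
  (proper_biharmonic I gam (metric CM) <->
   exists beta0 : R,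
     [/\ 0 < beta0 < 2 * pi,
         [/\ beta0 != pi / 2, beta0 != pi & beta0 != 3 * pi / 2],
         0 < (c + 3) / 4 - (c - 1) / 4 * cos beta0 ^+ 2 &
         [/\ circle I gam (metric CM) E kappa,
             forall a t, curve_dom I gam a t -> eta_velocity CM gam a t = cos beta0 &
             forall t, I t ->
               kappa 1%N t ^+ 2 = (c + 3) / 4 - (c - 1) / 4 * cos beta0 ^+ 2]
         \/
         [/\ helix I gam (metric CM) E kappa,
             forall a t, curve_dom I gam a t -> eta_velocity CM gam a t = cos beta0 &
             forall t, I t ->
               kappa 1%N t ^+ 2 + kappa 2%N t ^+ 2
               = (c + 3) / 4 - (c - 1) / 4 * cos beta0 ^+ 2]]).
Proof.
move=> _ sf c1 oI iI I0 fr nleg orth; split=> [pb|].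
  have [w [w0 /andP[w_gt w_lt] etaw kE]] :=
    proper_biharmonic_circle_or_helix sf c1 oI iI I0 fr nleg orth pb.
  (* The witness is acos w. From -1 < w < 1 it lies strictly between 0 and pi, hence differs from pi
     and 3 pi / 2, and w != 0 excludes pi / 2. *)
  have cw : cos (acos w) = w by apply: acosK; rewrite in_itv/= !ltW.
  have [pi0 a0 api] : [/\ 0 < pi :> R, 0 < acos w & acos w < pi].
    by split; [exact: pi_gt0|apply: acos_gt0; rewrite ltW|apply: acos_ltpi; rewrite w_gt ltW].
  have [t0 It0] := I0.
  exists (acos w); rewrite cw; split.
  - by rewrite a0; lra.
  - split; last by apply/eqP; lra.
      by apply: contra_neq w0 => aw; rewrite -cw aw cos_pihalf.
    by rewrite lt_eqF.
  (* The quantity to be positive equals kappa_1^2, plus kappa_2^2 for a helix, at any point of the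
     nonempty interval. *)
  - case: kE => -[[]]; last first.
      case=> _ _ /(_ 1%N isT)[_ /(_ t0 It0) k1] _ _ _ /(_ t0 It0) <-.
      by rewrite ltr_wpDr ?sqr_ge0 ?exprn_gt0.
    case=> _ _ /(_ 1%N isT)[_ /(_ t0 It0) k1] _ _ /(_ t0 It0) <-.
    by rewrite exprn_gt0.
  - by case: kE => -[? ?]; [left|right].
case=> beta0 [_ _ _ [[[fr2 k1] etab kE]|[[fr3 k1 k2] etab kE]]].
  apply: (circle_or_helix_proper_biharmonic sf oI I0 fr2 isT k1 _ orth etab) => // t It.
  by rewrite addr0 kE.
exact: (circle_or_helix_proper_biharmonic sf oI I0 fr3 isT k1 (fun=> k2) orth etab kE).
Qed.
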